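(* Let $(h_{m,t})_{1\le m\le M,\,t\ge0}$ be channel coefficients and assume there are constants $0<h_{\text{lb}}\le h_{\text{ub}}<\infty$ with $h_{\text{lb}}\le\min_m|h_{m,t}|\le h_{\text{ub}}$ for all $t$. Let $1<\beta<2$ and, for each horizon $T$, run AdaScale (defined in the context) with $V=V_0T^\beta$, where $V_0>0$ is a constant. Let $\hat x_t$ (depending on $T$) be its decisions and $x_t^\star$ (depending on $T$) an offline optimal solution of problem (P) with horizon $T$. Then: (i) There is a sequence $b_T\to0$ as $T\to\infty$ such that the dynamic regret satisfies $$\frac1T\sum_{t=0}^{T-1}\sum_{m=1}^M\Big(\rho_\alpha(q_m,\sigma_{m,t}(\hat x_t))-\rho_\alpha(q_m,\sigma_{m,t}(x^\star_t))\Big)\le b_T\quad\text{for all }T.$$ (ii) Assume moreover that conditions A1–A4 of the context hold, and that for each $T$, FedSGD with over-the-air aggregation (described in the context) is run for $T$ rounds with receive scaling factors $\eta_t=\hat x_t\,h_{\min,t}^2$ and learning rate $\lambda=\lambda_0/\sqrt T$, where $\lambda_0>0$ is a constant. Then $$\frac1T\sum_{t=0}^{T-1}\mathbb{E}\|\nabla f(\mathbf{w}_t)\|^2\to0\quad\text{as }T\to\infty.$$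
   Context: Parameters not depending on $T$: integers $M,d\ge1$ and $\alpha>1$; reals $\sigma_n,G,P_{\max}>0$ and $\nu\ge0$; integers $1\le B_m\le n_m$ and $q_m=B_m/n_m$, $k_m=\sqrt{1+(1-q_m)/B_m}$ for $m=1,\dots,M$. Put $h_{\min,t}=\min_m\frac{|h_{m,t}|}{k_m}$ and $x_{\max}=\frac{P_{\max}dM^2}{G^2}$. For $q\in(0,1]$, $\sigma>0$: $\rho_\alpha(q,\sigma)=\frac{1}{\alpha-1}\ln\big[\sum_{k=0}^{\alpha}\binom{\alpha}{k}(1-q)^{\alpha-k}q^k\exp\big(\frac{k^2-k}{2\sigma^2}\big)\big]$ (with $0^0=1$). For $x>0$: $\sigma_{m,t}(x)=\frac{MB_m\sigma_n}{\sqrt{2x}\,G\,h_{\min,t}}$. Problem (P) with horizon $T$: minimize $\frac1T\sum_{t=0}^{T-1}\sum_{m=1}^M\rho_\alpha(q_m,\sigma_{m,t}(x_t))$ over $(x_0,\dots,x_{T-1})$ subject to $\frac1T\sum_{t=0}^{T-1}\frac{d\sigma_n^2}{h_{\min,t}^2}\big(\frac1{x_t}-\frac1{x_{\max}}\big)\le\nu$ and $0<x_t\le x_{\max}$ for all $t$. The offline optimal solution is a minimizer of (P) with all $h_{m,t}$ known. AdaScale with parameter $V>0$ and horizon $T$: start with $Q_0=0$. For $t=0,\dots,T-1$, let $\hat x_t$ be a minimizer over $x\in(0,x_{\max}]$ of $$V\sum_{m=1}^M\rho_\alpha(q_m,\sigma_{m,t}(x))+Q_t\frac{d\sigma_n^2}{h_{\min,t}^2}\Big(\frac1x-\frac1{x_{\max}}\Big)+\frac12\Big(\frac{d\sigma_n^2}{h_{\min,t}^2}\Big)^2\Big(\frac1x-\frac1{x_{\max}}\Big)^2,$$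 and update the virtual queue $Q_{t+1}=\max\big\{Q_t+\frac{d\sigma_n^2}{h_{\min,t}^2}\big(\frac1{\hat x_t}-\frac1{x_{\max}}\big)-\nu,\,0\big\}$. FedSGD with over-the-air aggregation. Device $m$ ($1\le m\le M$) has $n_m$ samples $(\mathbf{u}_{m,i},o_{m,i})$, data distribution $p_m$, and a differentiable local loss $f_m:\mathbb{R}^d\to\mathbb{R}$, $f_m(\mathbf{w})=\mathbb{E}_{(\mathbf{u},o)\sim p_m}[c_ml(\mathbf{w};(\mathbf{u},o))]$, with $l$ a sample-wise loss and $c_m\in\mathbb{R}$; the global loss is $f=\frac1M\sum_mf_m$. The initial model $\mathbf{w}_0\in\mathbb{R}^d$ is deterministic and independent of $T$. In round $t$: each device $m$ draws a batch $\mathcal{B}_{m,t}\subseteq\{1,\dots,n_m\}$ by including each index independently with probability $q_m$ (independently of $\mathbf{w}_t$ and of the sample gradients), and computes $\mathbf{g}_{m,t}=\frac1{B_m}\sum_{i\in\mathcal{B}_{m,t}}\mathbf{g}_{m,t,i}$, where $\mathbf{g}_{m,t,i}=c_m\nabla l(\mathbf{w}_t;(\mathbf{u}_{m,i},o_{m,i}))$ is the (random) sample gradient, with $\|\mathbf{g}_{m,t,i}\|\le G$. Device $m$ transmits $\frac{\sqrt{\eta_t}}{Mh_{m,t}}\mathbf{g}_{m,t}$, the server receives $\mathbf{r}_t=\sum_m h_{m,t}\frac{\sqrt{\eta_t}}{Mh_{m,t}}\mathbf{g}_{m,t}+\mathbf{n}_t$ with $\mathbf{n}_t\sim\mathcal{CN}(0,\sigma_n^2\mathbb{I}^d)$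 independent of $\mathbf{w}_t$, the batches and the sample gradients, and updates $\mathbf{w}_{t+1}=\mathbf{w}_t-\lambda\,\mathrm{Re}(\mathbf{r}_t)/\sqrt{\eta_t}=\mathbf{w}_t-\lambda\big(\frac1M\sum_m\mathbf{g}_{m,t}+\tilde{\mathbf{n}}_t\big)$, $\tilde{\mathbf{n}}_t\sim\mathcal{N}(0,\frac{\sigma_n^2}{2\eta_t}\mathbb{I}^d)$. $\mathbb{E}$ is over batch sampling, sample gradient noise and receiver noise; channels are deterministic. Assumptions (with constants independent of $T$): A1: there is $L>0$ with $f_m(\mathbf{w})\le f_m(\mathbf{w}')+\langle\nabla f_m(\mathbf{w}'),\mathbf{w}-\mathbf{w}'\rangle+\frac L2\|\mathbf{w}-\mathbf{w}'\|^2$ for all $m,\mathbf{w},\mathbf{w}'$. A2: there is $\mathbf{w}^\star$ with $f(\mathbf{w}^\star)=f^\star\le f(\mathbf{w})$ for all $\mathbf{w}$. A3: there are $A_1,A_2\ge0$ such that $\mathbf{g}_{m,t,i}=\nabla f_m(\mathbf{w}_t)+\mathbf{z}_{m,t,i}$ with $\mathbb{E}[\mathbf{z}_{m,t,i}\mid\mathbf{w}_t]=0$ and $\mathbb{E}[\|\mathbf{z}_{m,t,i}\|^2\mid\mathbf{w}_t]\le A_1\|\nabla f_m(\mathbf{w}_t)\|^2+A_2$. A4: there are $C_1,C_2\ge0$ with $\frac1M\sum_m\|\nabla f_m(\mathbf{w})-\nabla f(\mathbf{w})\|^2\le C_1\|\nabla f(\mathbf{w})\|^2+C_2$ for all $\mathbf{w}$.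 *)

(* Defs.v *)
From HB Require Import structures.
From mathcomp Require Import all_boot all_order all_algebra.
From mathcomp Require Import complex.
From mathcomp Require Import all_classical all_reals all_analysis.
Import Order.TTheory GRing.Theory Num.Theory.
Import numFieldNormedType.Exports.

Set Implicit Arguments.
Unset Strict Implicit.
Unset Printing Implicit Defensive.

Local Open Scope classical_set_scope.
Local Open Scope ring_scope.

Record ota_params (R : realType) := OtaParams {
  ndev : nat;
  model_dim : nat;
  rdp_order : nat;
  noise_std : R;
  grad_bound : R;
  pow_max : R;
  noise_budget : R;
  batch_size : 'I_ndev -> nat;
  data_size : 'I_ndev -> nat;
  ndev_ge1 : (1 <= ndev)%N;
  model_dim_ge1 : (1 <= model_dim)%N;
  rdp_order_gt1 : (1 < rdp_order)%N;
  noise_std_gt0 : 0 < noise_std;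
  grad_bound_gt0 : 0 < grad_bound;
  pow_max_gt0 : 0 < pow_max;
  noise_budget_ge0 : 0 <= noise_budget;
  batch_size_ge1 : forall m, (1 <= batch_size m)%N;
  batch_le_data : forall m, (batch_size m <= data_size m)%N }.

Section scheduling.
Context {R : realType} (p : ota_params R).
Local Notation M := (ndev p).
Local Notation d := (model_dim p).

(* The range is finite, and nonempty since M >= 1, so the infimum is a minimum. *)
Definition dev_min (F : 'I_M -> R) : R := inf (range F).

(* The library's norm on R[i] takes values in R[i]; this one is real. *)
Definition cabs (z : R[i]) : R := ComplexField.Normc.normc z.

Definition rate (m : 'I_M) : R := (batch_size m)%:R / (data_size m)%:R.

Definition kfac (m : 'I_M) : R :=
  Num.sqrt (1 + (1 - rate m) / (batch_size m)%:R).

Definition xmax : R :=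
  pow_max p * d%:R * M%:R ^+ 2 / grad_bound p ^+ 2.

(* Renyi differential privacy of order a of the Gaussian mechanism with noise
   multiplier s and sampling rate q. For q = 1 the convention 0 ^ 0 = 1 that the
   sum relies on is that of ^+. *)
Definition rho (a : nat) (q s : R) : R :=
  (a%:R - 1)^-1 *
  ln (\sum_(k < a.+1) 'C(a, k)%:R * (1 - q) ^+ (a - k) * q ^+ k *
        expR ((k%:R ^+ 2 - k%:R) / (2 * s ^+ 2))).

Variable h : 'I_M -> nat -> R[i].

Definition hmin (t : nat) : R := dev_min (fun m => cabs (h m t) / kfac m).

Definition eff_std (m : 'I_M) (t : nat) (x : R) : R :=
  M%:R * (batch_size m)%:R * noise_std p /
  (Num.sqrt (2 * x) * grad_bound p * hmin t).

Definition privacy (m : 'I_M) (t : nat) (x : R) : R :=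
  rho (rdp_order p) (rate m) (eff_std m t x).

Definition excess_noise (t : nat) (x : R) : R :=
  d%:R * noise_std p ^+ 2 / hmin t ^+ 2 * (1 / x - 1 / xmax).

Definition offline_feasible (T : nat) (x : nat -> R) : Prop :=
  T%:R^-1 * (\sum_(t < T) excess_noise t (x t)) <= noise_budget p /\
  (forall t, (t < T)%N -> 0 < x t <= xmax).

Definition offline_objective (T : nat) (x : nat -> R) : R :=
  T%:R^-1 * \sum_(t < T) \sum_(m < M) privacy m t (x t).

Definition offline_optimal (T : nat) (x : nat -> R) : Prop :=
  offline_feasible T x /\
  (forall y, offline_feasible T y ->
     offline_objective T x <= offline_objective T y).

Fixpoint queue (x : nat -> R) (t : nat) : R :=
  if t is s.+1 then
    Num.max (queue x s + excess_noise s (x s) - noise_budget p) 0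
  else 0.

Definition adascale_objective (V Q : R) (t : nat) (x : R) : R :=
  V * (\sum_(m < M) privacy m t x) + Q * excess_noise t x
  + 2^-1 * ((d%:R * noise_std p ^+ 2 / hmin t ^+ 2) ^+ 2
            * (1 / x - 1 / xmax) ^+ 2).

Definition adascale (V : R) (T : nat) (x : nat -> R) : Prop :=
  forall t, (t < T)%N ->
    0 < x t <= xmax /\
    (forall y, 0 < y <= xmax ->
       adascale_objective V (queue x t) t (x t)
       <= adascale_objective V (queue x t) t y).

End scheduling.

(* 'rV[R]_n carries the max norm in the library: the Euclidean norm and inner
   product have to be written out. *)
Section euclidean.
Context {R : realType} {n : nat}.

Definition dotv (u v : 'rV[R]_n) : R := \sum_(j < n) u 0 j * v 0 j.

Definition enorm (v : 'rV[R]_n) : R := Num.sqrt (dotv v v).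

Definition grad (f : 'rV[R]_n -> R) (w : 'rV[R]_n) : 'rV[R]_n :=
  \row_(j < n) 'D_(delta_mx 0 j) f w.

End euclidean.

Section probability.
Context {d : measure_display} {Om : measurableType d} {R : realType}.
Variable P : probability Om R.

Definition random_vector n (X : Om -> 'rV[R]_n) : Prop :=
  forall j, measurable_fun setT (fun o => X o 0 j).

(* Generators of the sigma-algebra of a random vector, resp. of a random
   element of a finite type. *)
Definition vec_sys n (X : Om -> 'rV[R]_n) : set (set Om) :=
  \bigcup_j preimage_set_system setT (fun o => X o 0 j) measurable.

Definition fin_sys (S : finType) (X : Om -> S) : set (set Om) :=
  preimage_set_system setT X setT.

Definition independent_of (F H : set (set Om)) : Prop :=
  forall A B, F A -> H B -> P (A `&` B) = (P A * P B)%E.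

(* Y is a version of the conditional expectation E[X | F]. *)
Definition cond_expectation (F : set (set Om)) (X Y : Om -> R) : Prop :=
  [/\ P.-integrable setT (EFin \o X),
      P.-integrable setT (EFin \o Y),
      (forall B, measurable B -> F (Y @^-1` B)) &
      forall A, F A -> (\int[P]_(o in A) (Y o)%:E = \int[P]_(o in A) (X o)%:E)%E].

(* N ~ CN(0, s^2 I): the 2n real and imaginary parts of the coordinates are
   independent, each with law N(0, s^2 / 2). *)
Definition complex_gaussian n (s : R) (N : Om -> 'rV[R[i]]_n) : Prop :=
  [/\ random_vector (fun o => map_mx (@complex.Re R) (N o)),
      random_vector (fun o => map_mx (@complex.Im R) (N o)) &
      forall A B : 'I_n -> set R,
        (forall j, measurable (A j)) -> (forall j, measurable (B j)) ->
        P [set o | forall j, A j (complex.Re (N o 0 j)) /\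
                             B j (complex.Im (N o 0 j))] =
        (\prod_(j < n) (normal_prob 0 (s / Num.sqrt 2) (A j) *
                        normal_prob 0 (s / Num.sqrt 2) (B j)))%E].

End probability.

Section losses.
Context {R : realType} {p : ota_params R}.
Local Notation M := (ndev p).
Local Notation d := (model_dim p).
Context {dU dO : measure_display} {U : measurableType dU}
  {O : measurableType dO}.
Variable pdata : 'I_M -> probability (U * O)%type R.
Variables (c : 'I_M -> R) (l : 'rV[R]_d -> U * O -> R).

Definition local_loss (m : 'I_M) (w : 'rV[R]_d) : R :=
  fine 'E_(pdata m)[fun s => (c m * l w s)%R]%E.

Definition global_loss (w : 'rV[R]_d) : R :=
  M%:R^-1 * \sum_(m < M) local_loss m w.

(* Without integrability the expectation in local_loss, and without
   differentiability the directional derivatives in grad, would be junk values. *)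
Definition losses_well_defined : Prop :=
  [/\ (forall m w, (pdata m).-integrable setT (EFin \o (fun s => c m * l w s))),
      (forall m w, differentiable (local_loss m) w) &
      forall s w, differentiable (l^~ s) w].

Definition smooth_losses (L : R) : Prop :=
  forall m w w',
    local_loss m w <= local_loss m w' +
      dotv (grad (local_loss m) w') (w - w') + L / 2 * enorm (w - w') ^+ 2.

Definition minimum_attained : Prop :=
  exists wstar, forall w, global_loss wstar <= global_loss w.

Definition bounded_dissimilarity (C1 C2 : R) : Prop :=
  forall w,
    M%:R^-1 * (\sum_(m < M)
      enorm (grad (local_loss m) w - grad global_loss w) ^+ 2)
    <= C1 * enorm (grad global_loss w) ^+ 2 + C2.

End losses.

Section fedsgd.
Context {R : realType} {p : ota_params R}.
Local Notation M := (ndev p).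
Local Notation d := (model_dim p).
Local Notation n := (@data_size R p).
Context {dU dO : measure_display} {U : measurableType dU}
  {O : measurableType dO}.
Variable pdata : 'I_M -> probability (U * O)%type R.
Variables (c : 'I_M -> R) (l : 'rV[R]_d -> U * O -> R).
Variable h : 'I_M -> nat -> R[i].
Context {dOm : measure_display} {Om : measurableType dOm}.
Variable P : probability Om R.
Variable w : nat -> Om -> 'rV[R]_d.
(* The sample of index i of device m, as used in round t. A data set drawn once
   and for all, random or deterministic, is the case where xi does not depend
   on t. *)
Variable xi : nat -> forall m : 'I_M, 'I_(n m) -> {RV P >-> (U * O)%type}.
Variable batch : nat -> forall m : 'I_M, Om -> {set 'I_(n m)}.
Variable noise : nat -> Om -> 'rV[R[i]]_d.

Definition sample_grad (t : nat) (m : 'I_M) (i : 'I_(n m)) (o : Om) : 'rV[R]_d :=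
  c m *: grad (l^~ (xi t i o)) (w t o).

Definition batch_grad (t : nat) (m : 'I_M) (o : Om) : 'rV[R]_d :=
  (batch_size m)%:R^-1 *: \sum_(i in batch t m o) sample_grad t i o.

Definition transmitted (eta : nat -> R) (t : nat) (m : 'I_M) (o : Om) :
    'rV[R[i]]_d :=
  (real_complex R (Num.sqrt (eta t)) / (M%:R * h m t)) *:
  map_mx (real_complex R) (batch_grad t m o).

Definition received (eta : nat -> R) (t : nat) (o : Om) : 'rV[R[i]]_d :=
  \sum_(m < M) h m t *: transmitted eta t m o + noise t o.

Definition model_grad_sys (t : nat) : set (set Om) :=
  vec_sys (w t) `|` \bigcup_m \bigcup_(i : 'I_(n m)) vec_sys (sample_grad t i).

Definition noise_sys (t : nat) : set (set Om) :=
  vec_sys (fun o => map_mx (@complex.Re R) (noise t o)) `|`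
  vec_sys (fun o => map_mx (@complex.Im R) (noise t o)).

Record ota_fedsgd (lam : R) (eta : nat -> R) (w0 : 'rV[R]_d) (T : nat) : Prop :=
  OtaFedSGD {
  fedsgd_init : forall o, w 0 o = w0;
  fedsgd_batch_measurable : forall t m (S : {set 'I_(n m)}), (t < T)%N ->
    measurable (batch t m @^-1` [set S]);
  fedsgd_batch_law : forall t m (S : {set 'I_(n m)}), (t < T)%N ->
    P (batch t m @^-1` [set S]) =
    (\prod_(i < n m) (if i \in S then rate m else 1 - rate m))%:E;
  fedsgd_batch_indep : forall t m, (t < T)%N ->
    independent_of P <<s fin_sys (batch t m) >> <<s model_grad_sys t >>;
  fedsgd_grad_measurable : forall t m (i : 'I_(n m)), (t < T)%N ->
    random_vector (sample_grad t i);
  fedsgd_grad_bound : forall t m (i : 'I_(n m)), (t < T)%N ->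
    {ae P, forall o, enorm (sample_grad t i o) <= grad_bound p};
  fedsgd_noise_law : forall t, (t < T)%N ->
    complex_gaussian P (noise_std p) (noise t);
  fedsgd_noise_indep : forall t, (t < T)%N ->
    independent_of P <<s noise_sys t >>
      <<s model_grad_sys t `|` \bigcup_m fin_sys (batch t m) >>;
  fedsgd_update : forall t o, (t < T)%N ->
    w t.+1 o = w t o -
      (lam / Num.sqrt (eta t)) *: map_mx (@complex.Re R) (received eta t o) }.

Definition sample_noise (t : nat) (m : 'I_M) (i : 'I_(n m)) (o : Om) : 'rV[R]_d :=
  sample_grad t i o - grad (local_loss pdata c l m) (w t o).

Definition sample_noise_bounded (A1 A2 : R) (T : nat) : Prop :=
  forall t m (i : 'I_(n m)), (t < T)%N ->
    (forall j, cond_expectation P <<s vec_sys (w t) >>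
                 (fun o => sample_noise t i o 0 j) (cst 0)) /\
    (exists2 Y : Om -> R,
       cond_expectation P <<s vec_sys (w t) >>
         (fun o => enorm (sample_noise t i o) ^+ 2) Y &
       {ae P, forall o,
          Y o <= A1 * enorm (grad (local_loss pdata c l m) (w t o)) ^+ 2 + A2}).

End fedsgd.

(* Main.v *)
Require Import Defs.
From HB Require Import structures.
From mathcomp Require Import all_boot all_order all_algebra.
From mathcomp Require Import complex finmap.
From mathcomp Require Import all_classical all_reals all_analysis.
From mathcomp Require Import measurable_realfun.
From mathcomp Require Import ring lra.
Import Order.TTheory GRing.Theory Num.Theory.
Import numFieldNormedType.Exports.

Set Implicit Arguments.
Unset Strict Implicit.
Unset Printing Implicit Defensive.

Local Open Scope classical_set_scope.
Local Open Scope ring_scope.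

(** Regret. The one-slot objective dominates V (privacy) + (Q_{t+1}^2 - Q_t^2)/2
    - nu^2/2. Comparing its minimizer with x = xmax, where the
    excess noise vanishes, gives Q_t^2 <= 2 V c T; comparing it with the offline
    optimum and telescoping bounds the regret by nu sqrt(2 c T/V) + nu^2 T/V,
    which vanishes when T = o(V).

    Convergence. The smoothness inequality is summed along each trajectory before
    taking expectations, so that only f >= f(wstar) is needed and not the
    integrability of f(w_t). The gradient is a function of w_t, hence orthogonal
    to the sample noise and independent of the batches and of the receiver noise,
    so the cross terms reduce to E|grad f(w_t)|^2. The sum of the 1/eta_t is
    at most linear in Q_T + T nu, and Q_T / T^(3/2) -> 0 when V = o(T^2). *)

(** Conditional expectation and independence are given through events only, so the moment identities
    are brought back to one uniqueness principle: for nonnegative [f] and [z], the integral of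
    [f (phi x) * z x] is determined by the integrals of [z] over the preimages of Borel sets under
    [phi]. Orthogonality to a conditionally centred variable, products of independent variables, and
    the mean and variance of the Gaussian law all rest on it. To apply it, the gradient at w_t must
    be measurable for the sigma-algebra of w_t, which comes from difference quotients, and square
    integrable, which no assumption states: it is an almost surely bounded sample gradient minus a
    square-integrable sample noise. The second-moment constants are crude, since they only have to
    be independent of T. After division by lambda T, the initial gap f(w_0) - f(wstar) and the
    gradient part of the steps are of order T^(-1/2), while the receiver noise contributes T^(-3/2)
    times the sum of the 1/eta_t; this is the origin of the power 3/2 against which the queue is
    measured. *)

Section equal_weighted_laws.
Local Open Scope ereal_scope.
Import HBNNSimple.
Context {R : realType}.

(** The right-hand side sees [phi] and [z] only through integrals of [z] over preimages under [phi],
    which makes different pairs comparable. It is monotone convergence along simple functions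
    increasing to [f], composed with [phi] and split over their finitely many values. *)
Lemma weighted_integral_limit d (T : measurableType d)
    (mu : {measure set T -> \bar R}) (phi z : T -> R) (f : R -> R)
    (mf : measurable_fun setT (EFin \o f)) :
  measurable_fun setT phi -> measurable_fun setT z ->
  (forall x, 0 <= z x)%R -> (forall x, 0 <= f x)%R ->
  \int[mu]_x (f (phi x) * z x)%:E =
  limn (fun n => \sum_(r \in range (nnsfun_approx measurableT mf n))
    (r%:E * \int[mu]_(x in phi @^-1`
              (nnsfun_approx measurableT mf n @^-1` [set r])) (z x)%:E)).
Proof.
move=> mphi mz z0 f0; pose g := nnsfun_approx measurableT mf.
have mg n : measurable_fun setT (g n : R -> R) by [].
transitivity (limn (fun n => \int[mu]_x (g n (phi x) * z x)%:E)).
  rewrite -monotone_convergence//.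
  - apply: eq_integral => x _; apply/esym/cvg_lim => //=.
    under eq_fun do rewrite EFinM.
    rewrite EFinM; apply: cvgeZr => //.
    apply: (@cvg_nnsfun_approx _ _ _ setT _ (EFin \o f)) => //.
    by move=> t _; rewrite /= lee_fin.
  - move=> n; apply/measurable_EFinP/measurable_funM => //.
    exact: measurableT_comp.
  - by move=> n x _; rewrite lee_fin mulr_ge0.
  - move=> x _ m n mn; rewrite lee_fin ler_wpM2r//.
    exact/lefP/nd_nnsfun_approx.
congr (limn _); apply/funext => n.
transitivity (\int[mu]_x \sum_(r \in range (g n))
    (r%:E * (z x * \1_(phi @^-1` (g n @^-1` [set r])) x)%:E)).
  apply: eq_integral => x _.
  rewrite (fimfunE (g n)) /= fsbig_finite//= fsbig_finite//=.
  rewrite big_distrl /= -sumEFin; apply: eq_bigr => r _.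
  by rewrite -EFinM -mulrA [in LHS](mulrC _ (z x)).
have mA r : measurable (phi @^-1` (g n @^-1` [set r])).
  by rewrite -[X in measurable X]setTI; apply: mphi => //;
    rewrite -[X in measurable X]setTI; exact: mg.
have mzA r : measurable_fun setT
    (fun x => (z x * \1_(phi @^-1` (g n @^-1` [set r])) x)%:E).
  exact/measurable_EFinP/measurable_funM.
have intE r : \int[mu]_(x in phi @^-1` (g n @^-1` [set r])) (z x)%:E =
    \int[mu]_x (z x * \1_(phi @^-1` (g n @^-1` [set r])) x)%:E.
  rewrite integral_mkcond; apply: eq_integral => x _.
  rewrite patchE indicE; case: ifPn => _; first by rewrite mulr1.
  by rewrite mulr0.
have fsE (r : R) : r \in fset_set (range (g n)) -> range (g n) r.
  by rewrite in_fset_set// inE.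
(* Exchanging sum and integral requires a nonnegative summand for every real [r], also outside the
   range; cutting off negative [r] changes nothing on the range of a nonnegative simple function. *)
pose gg (r : R) x := if (0 <= r)%R then
   r%:E * (z x * \1_(phi @^-1` (g n @^-1` [set r])) x)%:E else 0.
have r0 (r : R) : r \in fset_set (range (g n)) -> (0 <= r)%R.
  by move=> /fsE[y _ <-]; exact: fun_ge0.
have finr : finite_set (range (g n)) by [].
rewrite fsbig_finite//=.
transitivity (\int[mu]_x \sum_(r <- fset_set (range (g n))) gg r x).
  apply: eq_integral => x _; rewrite fsbig_finite//= big_seq [RHS]big_seq.
  by apply: eq_bigr => r /r0 r0'; rewrite /gg r0'.
rewrite ge0_integral_sum//.
- rewrite big_seq [RHS]big_seq; apply: eq_bigr => r /r0 r0'.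
  rewrite intE -ge0_integralZl//.
  + by apply: eq_integral => x _; rewrite /gg r0'.
  + by move=> x _; rewrite lee_fin mulr_ge0.
- move=> r; rewrite /gg; have [r0'|_] := boolP (0 <= r)%R.
    exact: measurable_funeM.
  exact: measurable_cst.
- move=> r x _; rewrite /gg; case: ifP => // r0'.
  by rewrite mule_ge0// lee_fin// mulr_ge0.
Qed.

(** The hypothesis says that the measures of densities [z1] and [z2] have the same image under
    [phi1] and [phi2]. The simple functions approximating [f] depend on [f] alone, so both integrals
    are limits of the same sequence. *)
Lemma eq_weighted_integral d1 (T1 : measurableType d1)
    d2 (T2 : measurableType d2) (mu1 : {measure set T1 -> \bar R})
    (mu2 : {measure set T2 -> \bar R}) (phi1 z1 : T1 -> R) (phi2 z2 : T2 -> R)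
    (f : R -> R) :
  measurable_fun setT phi1 -> measurable_fun setT z1 ->
  measurable_fun setT phi2 -> measurable_fun setT z2 ->
  (forall x, 0 <= z1 x)%R -> (forall x, 0 <= z2 x)%R ->
  (forall B, measurable B -> \int[mu1]_(x in phi1 @^-1` B) (z1 x)%:E =
     \int[mu2]_(x in phi2 @^-1` B) (z2 x)%:E) ->
  measurable_fun setT f -> (forall x, 0 <= f x)%R ->
  \int[mu1]_x (f (phi1 x) * z1 x)%:E = \int[mu2]_x (f (phi2 x) * z2 x)%:E.
Proof.
move=> mphi1 mz1 mphi2 mz2 z10 z20 z12 mf f0.
have mEf : measurable_fun setT (EFin \o f) by exact/measurable_EFinP.
rewrite (weighted_integral_limit _ mEf)// (weighted_integral_limit _ mEf)//.
congr (limn _); apply/funext => n; apply: eq_fsbigr => r _; congr (_ * _).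
apply: z12; rewrite -[X in measurable X]setTI.
have mg : measurable_fun setT (nnsfun_approx measurableT mEf n : R -> R) by [].
exact: mg.
Qed.

End equal_weighted_laws.

(** * Square-integrable variables and orthogonality *)

Section square_integrable.
Context d (T : measurableType d) (R : realType) (P : probability T R).
Implicit Types X Y Z : T -> R.

(** Measurability of [X] is a separate clause, since integrability of the square gives only that of
    [X ^+ 2]. *)
Definition square_integrable X : Prop :=
  measurable_fun setT X /\ P.-integrable setT (EFin \o (fun o => X o ^+ 2)).

Lemma integrable_domin X Y : measurable_fun setT X ->
  (forall o, `|X o| <= Y o) -> P.-integrable setT (EFin \o Y) ->
  P.-integrable setT (EFin \o X).
Proof.
move=> mX XY iY; apply: le_integrable iY => //; first exact/measurable_EFinP.
by move=> o _; rewrite /= lee_fin (le_trans (XY o))// ler_norm.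
Qed.

Lemma integrable_add X Y : P.-integrable setT (EFin \o X) ->
  P.-integrable setT (EFin \o Y) ->
  P.-integrable setT (EFin \o (fun o => X o + Y o)).
Proof.
move=> iX iY; have := integrableD measurableT iX iY.
by apply: eq_integrable => // o _; rewrite /= EFinD.
Qed.

Lemma integrable_scale (k : R) X : P.-integrable setT (EFin \o X) ->
  P.-integrable setT (EFin \o (fun o => k * X o)).
Proof.
move=> iX; have := @integrableZl _ _ _ P setT measurableT k _ iX.
by apply: eq_integrable => // o _; rewrite /= EFinM.
Qed.

Lemma integrable_big_sum (I : Type) (s : seq I) (F : I -> T -> R) :
  (forall i, P.-integrable setT (EFin \o F i)) ->
  P.-integrable setT (EFin \o (fun o => \sum_(i <- s) F i o)).
Proof.
move=> iF; elim: s => [|i s IH].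
  apply: eq_integrable (integrable0 P setT) => // o _.
  by rewrite /= big_nil.
apply: eq_integrable (integrable_add (iF i) IH) => // o _.
by rewrite /= big_cons.
Qed.

Lemma Rintegral_big_sum (I : Type) (s : seq I) (F : I -> T -> R) :
  (forall i, P.-integrable setT (EFin \o F i)) ->
  \int[P]_o (\sum_(i <- s) F i o) = \sum_(i <- s) \int[P]_o F i o.
Proof.
move=> iF; elim: s => [|i s IH].
  rewrite big_nil -[RHS](mul0r (fine (P setT))) -Rintegral_cst//.
  by apply: eq_Rintegral => o _; rewrite big_nil.
rewrite big_cons -IH -RintegralD//; last exact: integrable_big_sum.
by apply: eq_Rintegral => o _; rewrite big_cons.
Qed.

Lemma square_integrable_mul X Y : square_integrable X -> square_integrable Y ->
  P.-integrable setT (EFin \o (fun o => X o * Y o)).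
Proof.
move=> [mX iX] [mY iY].
apply: integrable_domin (integrable_add iX iY); first exact: measurable_funM.
move=> o; rewrite normrM -(real_normK (num_real (X o))) -(real_normK (num_real (Y o))).
have := sqr_ge0 (`|X o| - `|Y o|); have := normr_ge0 (X o).
by have := normr_ge0 (Y o); nra.
Qed.

Lemma square_integrable_cst (k : R) : square_integrable (cst k).
Proof. by split => //; exact: (finite_measure_integrable_cst P (k ^+ 2)). Qed.

Lemma square_integrable_integrable X : square_integrable X ->
  P.-integrable setT (EFin \o X).
Proof.
move=> /square_integrable_mul/(_ (square_integrable_cst 1)).
by apply: eq_integrable => // o _; rewrite /= mulr1.
Qed.

Lemma square_integrable_domin X Y : measurable_fun setT X ->
  (forall o, X o ^+ 2 <= Y o) -> P.-integrable setT (EFin \o Y) ->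
  square_integrable X.
Proof.
move=> mX XY iY; split=> //; apply: integrable_domin iY.
  exact: measurable_funX.
by move=> o; rewrite ger0_norm ?sqr_ge0.
Qed.

Lemma square_integrableD X Y : square_integrable X -> square_integrable Y ->
  square_integrable (fun o => X o + Y o).
Proof.
move=> [mX iX] [mY iY].
apply: (@square_integrable_domin _ (fun o => 2 * (X o ^+ 2 + Y o ^+ 2))).
- exact: measurable_funD.
- by move=> o; have := sqr_ge0 (X o - Y o); nra.
- exact/integrable_scale/integrable_add.
Qed.

Lemma square_integrableZ (k : R) X : square_integrable X ->
  square_integrable (fun o => k * X o).
Proof.
move=> [mX iX].
apply: (@square_integrable_domin _ (fun o => k ^+ 2 * X o ^+ 2)).
- exact: measurable_funM.
- by move=> o; rewrite exprMn.
- exact: integrable_scale.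
Qed.

Lemma square_integrableB X Y : square_integrable X -> square_integrable Y ->
  square_integrable (fun o => X o - Y o).
Proof.
move=> sX /(square_integrableZ (-1))/(square_integrableD sX).
by under eq_fun do rewrite mulN1r.
Qed.

Lemma square_integrable_sum (I : Type) (s : seq I) (F : I -> T -> R) :
  (forall i, square_integrable (F i)) ->
  square_integrable (fun o => \sum_(i <- s) F i o).
Proof.
move=> sF; elim: s => [|i s IH].
  by under eq_fun do rewrite big_nil; exact: square_integrable_cst.
by under eq_fun do rewrite big_cons; exact: square_integrableD.
Qed.

Lemma square_integrable_ae_domin X Y : measurable_fun setT X ->
  (forall o, 0 <= Y o) -> {ae P, forall o, X o ^+ 2 <= Y o} ->
  P.-integrable setT (EFin \o Y) ->
  square_integrable X /\ \int[P]_o (X o ^+ 2) <= \int[P]_o Y o.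
Proof.
move=> mX Y0 XY iY.
have mX2 : measurable_fun setT (EFin \o (fun o => X o ^+ 2)).
  exact/measurable_EFinP/measurable_funX.
have le_int : (\int[P]_o (X o ^+ 2)%:E <= \int[P]_o (Y o)%:E)%E.
  apply: ae_ge0_le_integral => //.
  - by move=> o _; rewrite lee_fin sqr_ge0.
  - by move=> o _; rewrite lee_fin.
  - by case/integrableP: iY.
  - by apply: filterS XY => o /= XYo _; rewrite lee_fin.
have fY := integrable_fin_num measurableT iY.
have sX : square_integrable X.
  split=> //; apply/integrableP; split => //.
  under eq_integral do rewrite gee0_abs ?lee_fin ?sqr_ge0//.
  by apply: (le_lt_trans le_int); rewrite ltey_eq fY.
split=> //; apply: fine_le => //.
by case: sX => _; exact: integrable_fin_num.
Qed.

Lemma square_integrable_ae_bounded X (k : R) : measurable_fun setT X ->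
  {ae P, forall o, `|X o| <= k} ->
  square_integrable X /\ \int[P]_o (X o ^+ 2) <= k ^+ 2.
Proof.
move=> mX Xk.
have ck : P.-integrable setT (EFin \o (fun=> k ^+ 2)).
  exact: (finite_measure_integrable_cst P (k ^+ 2)).
have [||sX lX] := square_integrable_ae_domin mX _ _ ck.
- by move=> o; exact: sqr_ge0.
- apply: filterS Xk => o Xo; rewrite -(real_normK (num_real (X o))).
  by rewrite lerXn2r// nnegrE// (le_trans _ Xo).
split=> //; apply: (le_trans lX); rewrite Rintegral_cst//.
by rewrite [X in fine X](probability_setT) mulr1.
Qed.

(** A product of two square-integrable variables is merely integrable. With one factor bounded it
    stays square integrable and can be multiplied once more, as is done with the batch
    indicators. *)
Lemma square_integrable_mul_ae_bounded X Y (k : R) : square_integrable X ->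
  measurable_fun setT Y -> {ae P, forall o, `|Y o| <= k} ->
  square_integrable (fun o => X o * Y o).
Proof.
move=> [mX iX] mY Yk.
apply: (@square_integrable_ae_domin _ (fun o => k ^+ 2 * X o ^+ 2) _ _ _ _).1.
- exact: measurable_funM.
- by move=> o; rewrite mulr_ge0 ?sqr_ge0.
- apply: filterS Yk => o Yo; rewrite exprMn mulrC ler_wpM2r ?sqr_ge0//.
  rewrite -(real_normK (num_real (Y o))).
  by rewrite lerXn2r// nnegrE// (le_trans _ Yo).
- exact: integrable_scale.
Qed.

(* Both signs of [phi] and of [z] are matched separately through
   [eq_weighted_integral], then recombined. *)
Lemma Rintegral_mul_eq0 (phi z : T -> R) :
  square_integrable phi -> square_integrable z ->
  (forall B, measurable B -> \int[P]_(o in phi @^-1` B) z o = 0) ->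
  \int[P]_o (phi o * z o) = 0.
Proof.
move=> sphi sz hz; have [mphi iphi] := sphi; have [mz iz] := sz.
pose pp (u : T -> R) : T -> R := fun o => Num.max (u o) 0.
pose nn (u : T -> R) : T -> R := fun o => Num.max (- u o) 0.
have spp u : square_integrable u -> square_integrable (pp u).
  move=> [mu iu]; apply: square_integrable_domin iu.
    exact: measurable_maxr.
  move=> o; rewrite /pp; have [h|h] := leP (u o) 0 => //.
  by rewrite expr0n sqr_ge0.
have snn u : square_integrable u -> square_integrable (nn u).
  move=> [mu iu]; apply: square_integrable_domin iu.
    by apply: measurable_maxr => //; exact: measurableT_comp.
  move=> o; rewrite /nn; have [h|h] := leP (- u o) 0.
    by rewrite expr0n sqr_ge0.
  by rewrite sqrrN.
have ppnn u o : u o = pp u o - nn u o.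
  rewrite /pp /nn; have [h|h] := leP (u o) 0; have [k|k] := leP (- u o) 0;
    lra.
have pp0 u o : 0 <= pp u o by rewrite /pp le_max lexx orbT.
have nn0 u o : 0 <= nn u o by rewrite /nn le_max lexx orbT.
have ipz := square_integrable_integrable (spp _ sz).
have inz := square_integrable_integrable (snn _ sz).
have zE B : measurable B ->
    (\int[P]_(o in phi @^-1` B) (pp z o)%:E =
     \int[P]_(o in phi @^-1` B) (nn z o)%:E)%E.
  move=> mB.
  have mphiB : measurable (phi @^-1` B).
    by rewrite -[X in measurable X]setTI; exact: mphi.
  have ipB : P.-integrable (phi @^-1` B) (EFin \o pp z).
    exact: integrableS ipz.
  have inB : P.-integrable (phi @^-1` B) (EFin \o nn z).
    exact: integrableS inz.
  have : \int[P]_(o in phi @^-1` B) (pp z o - nn z o) = 0.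
    by rewrite -[RHS](hz B mB); apply: eq_Rintegral => o _; rewrite -ppnn.
  rewrite RintegralB// => /eqP; rewrite subr_eq0 /Rintegral => /eqP hE.
  by move: (congr1 EFin hE); rewrite !fineK//; exact: integrable_fin_num.
have fE (f : R -> R) : measurable_fun setT f -> (forall x, 0 <= f x) ->
    \int[P]_o (f (phi o) * pp z o) = \int[P]_o (f (phi o) * nn z o).
  move=> mf f0; rewrite /Rintegral; congr fine.
  apply: eq_weighted_integral => //.
  - exact: (spp _ sz).1.
  - exact: (snn _ sz).1.
have e1 := fE (fun x => Num.max x 0).
have e2 := fE (fun x => Num.max (- x) 0).
have {}e1 : \int[P]_o (pp phi o * pp z o) = \int[P]_o (pp phi o * nn z o).
  by apply: e1 => [|x]; [exact: measurable_maxr|rewrite le_max lexx orbT].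
have {}e2 : \int[P]_o (nn phi o * pp z o) = \int[P]_o (nn phi o * nn z o).
  apply: e2 => [|x]; last by rewrite le_max lexx orbT.
  by apply: measurable_maxr => //; exact: measurableT_comp.
pose F1 o := pp phi o * pp z o - pp phi o * nn z o.
pose F2 o := nn phi o * pp z o - nn phi o * nn z o.
have im u v : square_integrable u -> square_integrable v ->
  P.-integrable setT (EFin \o (fun o => u o * v o)) by exact: square_integrable_mul.
have iB u v : P.-integrable setT (EFin \o u) -> P.-integrable setT (EFin \o v) ->
    P.-integrable setT (EFin \o (fun o => u o - v o)).
  move=> iu /(integrable_scale (-1))/(integrable_add iu).
  by apply: eq_integrable => // o _; rewrite /= mulN1r.
have i1 : P.-integrable setT (EFin \o F1).
  by apply: iB; apply: im; auto.
have i2 : P.-integrable setT (EFin \o F2).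
  by apply: iB; apply: im; auto.
transitivity (\int[P]_o (F1 o - F2 o)).
  apply: eq_Rintegral => o _.
  by rewrite /F1 /F2 (ppnn phi) (ppnn z); ring.
rewrite RintegralB// /F1 /F2 RintegralB//; [|by apply: im; auto..].
rewrite RintegralB//; [|by apply: im; auto..].
by rewrite e1 e2 !subrr.
Qed.

End square_integrable.

(** * Expectation of a product of independent variables *)

Section independence.
Context d (T : measurableType d) (R : realType) (P : probability T R).

(** Orthogonality is used twice. The centred indicator of X in B integrates to zero over every event
    Y in C, which yields the integral of [Y] over X in B; hence [Y] minus its mean integrates to
    zero over every event X in B, and is orthogonal to [X]. *)
Lemma Rintegral_mul_independent (X Y : T -> R) :
  square_integrable P X -> square_integrable P Y ->
  (forall B C, measurable B -> measurable C ->
     P (X @^-1` B `&` Y @^-1` C) = (P (X @^-1` B) * P (Y @^-1` C))%E) ->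
  \int[P]_o (X o * Y o) = \int[P]_o X o * \int[P]_o Y o.
Proof.
move=> sX sY XY; have [mX _] := sX; have [mY _] := sY.
have mpre (Z : T -> R) B : measurable_fun setT Z -> measurable B ->
    measurable (Z @^-1` B).
  by move=> mZ mB; rewrite -[X in measurable X]setTI; exact: mZ.
have sB A (k : R) : measurable A ->
    square_integrable P (fun o => (\1_A o : R) - k).
  move=> mA; apply: square_integrableB; last exact: square_integrable_cst.
  apply: (@square_integrable_ae_bounded _ _ _ _ _ 1 _ _).1 => //.
  apply: aeW => o; rewrite indicE; case: (_ \in _) => /=.
    by rewrite normr1.
  by rewrite normr0 ler01.
have RI (A C : set T) : measurable A -> measurable C ->
    \int[P]_(o in C) (\1_A o : R) = fine (P (A `&` C)).
  by move=> mA mC; rewrite /Rintegral integral_indic// setIC.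
have iX := square_integrable_integrable sX.
have iY := square_integrable_integrable sY.
have XB B : measurable B ->
    \int[P]_(o in X @^-1` B) Y o = fine (P (X @^-1` B)) * \int[P]_o Y o.
  move=> mB; have mXB := mpre X B mX mB.
  have s1 := sB _ (fine (P (X @^-1` B))) mXB.
  have := Rintegral_mul_eq0 sY s1.
  have -> : \int[P]_o (Y o * (\1_(X @^-1` B) o - fine (P (X @^-1` B)))) =
     \int[P]_(o in X @^-1` B) Y o - fine (P (X @^-1` B)) * \int[P]_o Y o.
    rewrite -RintegralZl// [X in _ = X - _]Rintegral_mkcond -RintegralB//.
    - apply: eq_Rintegral => o _; rewrite patchE indicE.
      case: (_ \in _); rewrite /= ?mulr1n ?mulr0n; first by ring.
      (* Off the event the restricted function takes the default value [point], which is 0 in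
         [R]. *)
      by have -> : point = 0 :> R by []; ring.
    - have := integrableS measurableT mXB (@subsetT _ _) iY.
      move=> /(integrable_mkcond _ mXB).
      by apply: eq_integrable => // o _; rewrite restrict_EFin.
    - exact: integrable_scale.
  move=> H; apply/eqP; rewrite -subr_eq0; apply/eqP; apply: H => C mC.
  have mYC := mpre Y C mY mC.
  rewrite RintegralB//; last 2 first.
  - apply: (integrableS measurableT) => //.
    exact: integrable_indic.
  - apply: (integrableS measurableT) => //.
    exact: finite_measure_integrable_cst.
  rewrite RI// Rintegral_cst// XY// fineM ?fin_num_measure//.
  by rewrite subrr.
have sYc : square_integrable P (fun o => Y o - \int[P]_o Y o).
  by apply: square_integrableB => //; exact: square_integrable_cst.
have := Rintegral_mul_eq0 sX sYc.
have -> : \int[P]_o (X o * (Y o - \int[P]_o Y o)) =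
    \int[P]_o (X o * Y o) - \int[P]_o X o * \int[P]_o Y o.
  rewrite -RintegralZr// -RintegralB//.
  - by apply: eq_Rintegral => o _; rewrite mulrBr.
  - exact: square_integrable_mul.
  - have := integrable_scale (\int[P]_o Y o) iX.
    by apply: eq_integrable => // o _; rewrite /= mulrC.
move=> H; apply/eqP; rewrite -subr_eq0; apply/eqP; apply: H => B mB.
have mXB := mpre X B mX mB.
rewrite RintegralB//; last 2 first.
- exact: (integrableS measurableT).
- apply: (integrableS measurableT) => //.
  exact: finite_measure_integrable_cst.
by rewrite XB// Rintegral_cst// mulrC subrr.
Qed.

End independence.

(** * The centred normal law: finite variance and zero mean *)

Section normal_law.
Context (R : realType) (s : R).
Hypothesis s_gt0 : 0 < s.
Local Notation leb := (@lebesgue_measure R).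
Local Notation pdf := (normal_pdf (0 : R) s).

(** Doubling the standard deviation slows the decay enough to absorb the square: with u = x^2 / (8
    s^2), the two exponentials are exp(-4u) and exp(-u), and u <= exp(u). The quotient of peaks in
    [K] adjusts the normalizations. *)
Lemma normal_pdf_sqr_le : exists K : R,
  forall x : R, x ^+ 2 * pdf x <= K * normal_pdf 0 (2 * s) x.
Proof.
have s0 : s != 0 by rewrite gt_eqF.
have s20 : 2 * s != 0 by rewrite mulf_neq0// pnatr_eq0.
exists (8 * s ^+ 2 * normal_peak s / normal_peak (2 * s)) => x.
rewrite !normal_pdfE// -[in leRHS]mulrA mulKf ?gt_eqF ?normal_peak_gt0//.
rewrite mulrCA [in leRHS](mulrC (8 * _)) -[in leRHS]mulrA.
rewrite ler_pM2l ?normal_peak_gt0// /normal_fun subr0.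
pose u := x ^+ 2 / (8 * s ^+ 2).
have ps : 0 < s ^+ 2 by rewrite exprn_gt0.
have -> : - x ^+ 2 / (s ^+ 2 *+ 2) = - (4 * u).
  by rewrite /u -mulr_natr; field.
have -> : - x ^+ 2 / ((2 * s) ^+ 2 *+ 2) = - u.
  by rewrite /u -mulr_natr; field.
have -> : x ^+ 2 = 8 * s ^+ 2 * u by rewrite /u; field.
rewrite -[leLHS]mulrA ler_pM2l; last by rewrite mulr_gt0.
have u0 : 0 <= u by rewrite divr_ge0 ?sqr_ge0// mulr_ge0// sqr_ge0.
apply: (@le_trans _ _ (expR u * expR (- (4 * u)))).
  rewrite ler_wpM2r ?expR_ge0//; have := expR_ge1Dx u; lra.
rewrite -expRD ler_expR; lra.
Qed.

(** The variance, kept as an integral: any constant independent of the round and of the horizon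
    serves. *)
Definition normal_second_moment : R := \int[leb]_x (x ^+ 2 * pdf x).

Lemma integrable_sqr_normal_pdf :
  leb.-integrable setT (EFin \o (fun x => x ^+ 2 * pdf x)).
Proof.
have [K xK] := normal_pdf_sqr_le.
apply: (@le_integrable _ _ _ leb setT measurableT _
    (EFin \o (fun x => K * normal_pdf 0 (2 * s) x))).
- apply/measurable_EFinP/measurable_funM; last exact: measurable_normal_pdf.
  by apply: measurable_funX.
- move=> x _; rewrite /= lee_fin ger0_norm.
    exact: le_trans (xK x) (ler_norm _).
  by rewrite mulr_ge0 ?sqr_ge0 ?normal_pdf_ge0.
- have := integrableZl measurableT K (integrable_normal_pdf 0 (2 * s)).
  by apply: eq_integrable => // x _; rewrite /= EFinM.
Qed.

(** Lebesgue measure is invariant under negation and the centred density is even. *)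
Lemma integral_normal_pdf_opp (B : set R) : measurable B ->
  (\int[leb]_(x in B) (pdf x)%:E =
   \int[leb]_(x in (fun x : R => (- x)%R) @^-1` B) (pdf x)%:E)%E.
Proof.
move=> mB.
transitivity (\int[pushforward leb (-%R : _ -> measurableTypeR R)]_(x in B)
    (pdf x)%:E)%E.
  by apply: eq_measure_integral => A mA _; exact/esym/lebesgue_measureN.
rewrite ge0_integral_pushforward//.
- apply: eq_integral => x _ /=; congr EFin.
  by rewrite !normal_pdfE ?gt_eqF// /normal_fun !subr0 sqrrN.
- apply: measurable_funTS; apply/measurable_EFinP.
  exact: measurable_normal_pdf.
- by move=> x _; rewrite lee_fin normal_pdf_ge0.
Qed.

Context d (T : measurableType d) (P : probability T R) (X : T -> R).
Hypothesis mX : measurable_fun setT X.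
Hypothesis lawX : forall B, measurable B -> P (X @^-1` B) = normal_prob 0 s B.

Lemma ge0_integral_normal_law (f : R -> R) : measurable_fun setT f ->
  (forall x, 0 <= f x) ->
  (\int[P]_o (f (X o))%:E = \int[leb]_x (f x * pdf x)%:E)%E.
Proof.
move=> mf f0; transitivity (\int[P]_o (f (X o) * cst 1 o)%:E)%E.
  by apply: eq_integral => o _; rewrite /= mulr1.
apply: (@eq_weighted_integral R _ T _ (measurableTypeR R) P leb X (cst 1) id
  pdf f) => //.
- exact: measurable_normal_pdf.
- by move=> x; exact: normal_pdf_ge0.
- move=> B mB; transitivity (P (X @^-1` B)); last exact: lawX.
  transitivity (1 * P (X @^-1` B))%E; last by rewrite mul1e.
  have mXB : measurable (X @^-1` B).
    by rewrite -[X in measurable X]setTI; exact: mX.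
  exact: (@integral_cst _ _ _ P _ mXB 1%E).
Qed.

Lemma square_integrable_normal : square_integrable P X.
Proof.
split=> //; apply/integrableP; split.
  exact/measurable_EFinP/measurable_funX.
under eq_integral do rewrite gee0_abs ?lee_fin ?sqr_ge0//.
have sq0 (x : R) : 0 <= x ^+ 2 by exact: sqr_ge0.
have msq : measurable_fun setT (fun x : R => x ^+ 2) by exact: measurable_funX.
rewrite (ge0_integral_normal_law msq sq0).
have /integrableP[_] := integrable_sqr_normal_pdf.
apply: le_lt_trans; apply: ge0_le_integral => //.
- by move=> x _; rewrite lee_fin mulr_ge0 ?sqr_ge0 ?normal_pdf_ge0.
- by case/integrableP: integrable_sqr_normal_pdf.
- by apply: measurableT_comp => //; case/integrableP: integrable_sqr_normal_pdf.
- by move=> x _; rewrite /= lee_fin ler_norm.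
Qed.

Lemma Rintegral_sqr_normal : \int[P]_o (X o ^+ 2) = normal_second_moment.
Proof.
have sq0 (x : R) : 0 <= x ^+ 2 by exact: sqr_ge0.
have msq : measurable_fun setT (fun x : R => x ^+ 2) by exact: measurable_funX.
by rewrite /Rintegral (ge0_integral_normal_law msq sq0).
Qed.

(** By symmetry of the law: the positive part and the negative part have equal integrals, because on
    the real line [id] and the negation, both weighted by the density, have the same image
    measure. *)
Lemma Rintegral_normal : \int[P]_o X o = 0.
Proof.
have iX := square_integrable_integrable square_integrable_normal.
pose pp (x : R) : R := Num.max x 0.
pose nn (x : R) : R := Num.max (- x) 0.
have mpp : measurable_fun setT pp by exact: measurable_maxr.
have mnn : measurable_fun setT nn.
  by apply: measurable_maxr => //; exact: measurableT_comp.
have pp0 x : 0 <= pp x by rewrite /pp le_max lexx orbT.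
have nn0 x : 0 <= nn x by rewrite /nn le_max lexx orbT.
have ppX : P.-integrable setT (EFin \o (fun o => pp (X o))).
  apply: (@integrable_domin _ _ _ _ _ (fun o => `|X o|)).
  - exact: measurableT_comp.
  - move=> o; rewrite ger0_norm// /pp ge_max normr_ge0 andbT; exact: ler_norm.
  - by have := integrable_abse iX; apply: eq_integrable.
have nnX : P.-integrable setT (EFin \o (fun o => nn (X o))).
  apply: (@integrable_domin _ _ _ _ _ (fun o => `|X o|)).
  - exact: measurableT_comp.
  - move=> o; rewrite ger0_norm// /nn ge_max normr_ge0 andbT.
    by rewrite -normrN ler_norm.
  - by have := integrable_abse iX; apply: eq_integrable.
transitivity (\int[P]_o (pp (X o) - nn (X o))).
  apply: eq_Rintegral => o _; rewrite /pp /nn.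
  by have [h|h] := leP (X o) 0; have [k|k] := leP (- X o) 0; lra.
rewrite RintegralB//; apply/eqP; rewrite subr_eq0; apply/eqP.
rewrite /Rintegral; congr fine.
rewrite (ge0_integral_normal_law mpp)// (ge0_integral_normal_law mnn)//.
apply: (@eq_weighted_integral R _ (measurableTypeR R) _ (measurableTypeR R)
  leb leb id pdf (fun x : R => - x) pdf pp) => //.
- exact: measurable_normal_pdf.
- exact: oppr_measurable.
- exact: measurable_normal_pdf.
- by move=> x; exact: normal_pdf_ge0.
- by move=> x; exact: normal_pdf_ge0.
- exact: integral_normal_pdf_opp.
Qed.

End normal_law.

(** * Measurability of the gradient at a random point *)

Section measurable_gradient.
Context d (T : measurableType d) (R : realType) (n : nat).
Variable X : T -> 'rV[R]_n.
Hypothesis mX : forall j, measurable_fun setT (fun o => X o 0 j).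

(* An open set of row vectors is a countable union of rational cubes. *)
Lemma measurable_continuous_comp (g : 'rV[R]_n -> R) : continuous g ->
  measurable_fun setT (fun o => g (X o)).
Proof.
move=> cg; apply: (measurability _ (RGenOInfty.measurableE R)) => //.
move=> _ [_ [a ->] <-]; rewrite setTI.
pose inside (i : 'rV[rat]_n * nat) :=
  `[< forall y : 'rV[R]_n,
        (forall j, `|y 0 j - ratr (i.1 0 j)| < i.2.+1%:R^-1) -> a < g y >].
pose F (i : 'rV[rat]_n * nat) : set T := if inside i then
  \bigcap_(j in [set: 'I_n])
    [set o | `|X o 0 j - ratr (i.1 0 j)| < i.2.+1%:R^-1] else set0.
rewrite (_ : _ @^-1` _ = \bigcup_i F i).
  apply: countable_bigcupT_measurable => // i; rewrite /F.
  case: ifP => _ //; apply: fin_bigcap_measurable => [//|j _].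
  have mlt : measurable_fun setT
      (fun o => `|X o 0 j - ratr (i.1 0 j)| < i.2.+1%:R^-1).
    apply: measurable_fun_ltr => //.
    by apply: measurableT_comp => //; exact: measurable_funB.
  by have := mlt measurableT [set true] I; rewrite setTI.
apply/seteqP; split => [w /=|w [i _]].
  rewrite in_itv/= andbT => awo.
  have : nbhs (X w) [set y | a < g y].
    exact: (cg (X w)) _ (lt_nbhsr awo).
  move=> /nbhs_ballP[e /= e0 eg].
  have [k ke] : exists k : nat, (k.+1%:R^-1 : R) < e / 2.
    have [k _ /(_ k (leqnn k))] :=
      near_infty_natSinv_lt (PosNum (divr_gt0 e0 (ltr0n R 2))).
    by exists k.
  have kgt0 : 0 < (k.+1%:R^-1 : R) by rewrite invr_gt0 ltr0n.
  have /choice[q qP] : forall j, exists q : rat,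
      `|X w 0 j - ratr q| < k.+1%:R^-1.
    move=> j; have /rat_in_itvoo[q] : X w 0 j < X w 0 j + k.+1%:R^-1.
      by rewrite ltrDl.
    rewrite in_itv/= => /andP[q1 q2]; exists q.
    by rewrite distrC ger0_norm ?subr_ge0 ?ltW// ltrBlDl.
  exists (\row_j q j, k) => //; rewrite /F.
  have -> : inside (\row_j q j, k).
    apply/asboolP => y /= yq; apply: eg; split => // i j.
    rewrite (ord1 i) /ball/= -(subrK (ratr (q j)) (X w 0 j)) -addrA.
    apply: le_lt_trans (ler_normD _ _) _.
    have := yq j; have := qP j; rewrite mxE (distrC (y _ _)).
    move: ke; set r := k.+1%:R^-1; set u := `|_|; set v := `|_|.
    lra.
  by move=> j _ /=; rewrite mxE.
rewrite /F; case: ifPn => //= /asboolP iP Fw.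
by rewrite in_itv/= andbT; apply: iP => j; exact: Fw.
Qed.

(** A partial derivative is the limit of difference quotients with steps 1/(k+1), each continuous in
    the point. The source space is arbitrary, so it may carry just the sigma-algebra generated by
    [X]; this is how the gradient is seen to be a function of w_t. *)
Lemma measurable_grad (f : 'rV[R]_n -> R) (j : 'I_n) :
  (forall x, differentiable f x) ->
  measurable_fun setT (fun o => grad f (X o) 0 j).
Proof.
move=> df.
have cf : continuous f by move=> x; exact: differentiable_continuous.
pose q (k : nat) (x : 'rV[R]_n) : R :=
  k.+1%:R * (f (k.+1%:R^-1 *: delta_mx 0 j + x) - f x).
apply: (@measurable_fun_cvg _ _ _ setT (fun k o => q k (X o))).
  move=> k; apply: measurable_continuous_comp => x; rewrite /continuous_at /q.
  have c1 : (fun y => f (k.+1%:R^-1 *: delta_mx 0 j + y)) @ x -->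
      f (k.+1%:R^-1 *: delta_mx 0 j + x).
    have c0 : (fun y => k.+1%:R^-1 *: delta_mx 0 j + y) @ x -->
        k.+1%:R^-1 *: delta_mx 0 j + x.
      exact: (@cvgD R 'rV[R]_n _ (nbhs x) _
        (cst (k.+1%:R^-1 *: delta_mx 0 j)) id _ _ (cvg_cst _) cvg_id).
    exact: (cvg_comp _ _ c0 (cf _)).
  exact: (cvgMl_tmp (cvgB c1 (cf x))).
move=> o _; rewrite mxE.
have : derivable f (X o) (delta_mx 0 j) by exact: diff_derivable.
rewrite /derivable.
set l := 'D_ _ _ _ => fl.
have h0 : (fun k : nat => k.+1%:R^-1 : R) @ \oo --> 0^'.
  move=> A [e /= e0 eA].
  apply: (filterS _ (near_infty_natSinv_lt (PosNum e0))) => k /= ke.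
  apply: eA; last by rewrite /= invr_eq0 pnatr_eq0.
  by rewrite /ball_/= sub0r normrN ger0_norm ?invr_ge0.
have := cvg_comp _ _ h0 fl.
apply: cvg_trans; apply: near_eq_cvg; near=> k.
by rewrite /= /q invrK.
Unshelve. all: by end_near.
Qed.

End measurable_gradient.

(** * Virtual queue: drift-plus-penalty estimates for abstract sequences *)

Section drift_plus_penalty.
Context (R : realType) (T : nat) (V c nu : R) (F Q u : nat -> R).
Hypotheses (V_gt0 : 0 < V) (c_ge0 : 0 <= c) (nu_ge0 : 0 <= nu).
Hypothesis Q0 : Q 0 = 0.
Hypothesis QS : forall t, Q t.+1 = Num.max (Q t + u t - nu) 0.
Hypothesis u_ge0 : forall t, (t < T)%N -> 0 <= u t.
Hypothesis F_ge0 : forall t, (t < T)%N -> 0 <= F t.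
Hypothesis penalty_le : forall t, (t < T)%N ->
  V * F t + Q t * u t + 2^-1 * u t ^+ 2 <= V * c.

Lemma queue_ge0 t : 0 <= Q t.
Proof. by case: t => [|t]; rewrite ?Q0 // QS le_max lexx orbT. Qed.

(** Squaring [Q t.+1 <= Q t + u t] gives an increment of 2 Q u + u^2, which is twice the part of the
    one-slot objective without [F]; by [penalty_le] it is at most 2 V c. The quadratic term of the
    objective thus takes the place of an a priori bound on the arrivals. *)
Lemma queue_sqr_le t : (t <= T)%N -> Q t ^+ 2 <= 2 * V * c * t%:R.
Proof.
elim: t => [_|t IH tT]; first by rewrite Q0 mulr0 expr0n.
have := IH (ltnW tT); have := penalty_le tT; have := u_ge0 tT.
have VF : 0 <= V * F t by rewrite mulr_ge0 ?F_ge0// ltW.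
have Qt := queue_ge0 t; have Qt1 := queue_ge0 t.+1.
have QSle : 0 <= u t -> Q t.+1 <= Q t + u t.
  by move=> ut; rewrite QS ge_max lerBlDr lerDl nu_ge0 addr_ge0.
move=> ut pen hyp; have q1 := QSle ut.
have q2 : Q t.+1 ^+ 2 <= (Q t + u t) ^+ 2 by rewrite lerXn2r ?nnegrE//; lra.
apply: (le_trans q2); rewrite -(natr1 t) mulrDr mulr1.
have -> : (Q t + u t) ^+ 2 = Q t ^+ 2 + 2 * (Q t * u t + 2^-1 * u t ^+ 2).
  by field.
lra.
Qed.

Lemma queue_le t : (t <= T)%N -> Q t <= Num.sqrt (2 * V * c * T%:R).
Proof.
move=> tT; rewrite -(ger0_norm (queue_ge0 t)) -sqrtr_sqr; apply: ler_wsqrtr.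
apply: (le_trans (queue_sqr_le tT)).
by rewrite ler_wpM2l ?ler_nat// !mulr_ge0// ltW.
Qed.

Lemma sum_arrivals_le : \sum_(t < T) u t <= Q T + T%:R * nu.
Proof.
elim: T => [|t IH]; first by rewrite big_ord0 Q0 mul0r addr0.
rewrite big_ord_recr /= QS -(natr1 t) mulrDl mul1r.
have : Q t + u t - nu <= Num.max (Q t + u t - nu) 0 by rewrite le_max lexx.
lra.
Qed.

(** The comparator meets the budget only on average, so its arrivals come multiplied by queue
    lengths varying with t. Replacing each of these by the uniform bound of [queue_le] leaves just
    the sum of the [us t]. *)
Lemma drift_plus_penalty_regret (Fs us : nat -> R) :
  (forall t, (t < T)%N -> 0 <= us t) ->
  (forall t, (t < T)%N ->
     V * F t + Q t * u t + 2^-1 * u t ^+ 2 <=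
     V * Fs t + Q t * us t + 2^-1 * us t ^+ 2) ->
  \sum_(t < T) us t <= T%:R * nu ->
  V * (\sum_(t < T) (F t - Fs t)) <=
    Num.sqrt (2 * V * c * T%:R) * (T%:R * nu) + 2^-1 * (T%:R * nu) ^+ 2 +
    2^-1 * (T%:R * nu ^+ 2).
Proof.
move=> us0 cmp sus; set q := Num.sqrt _.
have q0 : 0 <= q by exact: sqrtr_ge0.
(* The squares of the [us s] are controlled by the square of their partial sum, which grows by at
   least the new square because the terms are nonnegative. The last term collects the nu^2 / 2 left
   by each drift. *)
have key t : (t <= T)%N ->
    V * (\sum_(s < t) (F s - Fs s)) + 2^-1 * Q t ^+ 2 <=
    q * (\sum_(s < t) us s) + 2^-1 * (\sum_(s < t) us s) ^+ 2 +
    2^-1 * (t%:R * nu ^+ 2).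
  elim: t => [_|t IH tT].
    by rewrite !big_ord0 Q0 !(mulr0, mul0r, expr0n) !addr0.
  rewrite !big_ord_recr /=; have {}IH := IH (ltnW tT).
  set S := \sum_(s < t) (F s - Fs s) in IH *.
  have U0 : 0 <= \sum_(s < t) us s.
    by apply: sumr_ge0 => s _; rewrite us0// (ltn_trans _ tT).
  set U := \sum_(s < t) us s in IH U0 *.
  have := cmp t tT; have := us0 t tT; have := u_ge0 tT.
  have := queue_le (ltnW tT); rewrite -/q => Qq ut ust cmpt.
  have Qt := queue_ge0 t.
  have drift : Q t.+1 ^+ 2 <= (Q t + u t - nu) ^+ 2.
    rewrite QS; have [h|h] := leP (Q t + u t - nu) 0; last by [].
    by rewrite expr0n sqr_ge0.
  have h1 : Q t * us t <= q * us t by rewrite ler_wpM2r.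
  have h2 : 0 <= U * us t by rewrite mulr_ge0.
  have h3 : 0 <= Q t * nu by rewrite mulr_ge0.
  have h4 : 0 <= u t * nu by rewrite mulr_ge0.
  rewrite -(natr1 t) mulrDl mul1r; nra.
have U0 : 0 <= \sum_(s < T) us s.
  by apply: sumr_ge0 => s _; rewrite us0.
have := key T (leqnn T); set U := \sum_(s < T) us s in sus U0 *.
have Qs := sqr_ge0 (Q T).
have : q * U <= q * (T%:R * nu) by rewrite ler_wpM2l.
have : U ^+ 2 <= (T%:R * nu) ^+ 2 by rewrite lerXn2r// nnegrE// (le_trans U0).
lra.
Qed.

End drift_plus_penalty.

(** * Uniform bounds on the channels and on the privacy loss *)

Section channel_bounds.
Context (R : realType) (p : ota_params R) (h : 'I_(ndev p) -> nat -> R[i]).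
Context (h_lb h_ub : R).
Hypothesis h_lb_gt0 : 0 < h_lb.
Hypothesis h_bounds : forall t, h_lb <= dev_min (fun m => cabs (h m t)) <= h_ub.
Implicit Types (m : 'I_(ndev p)) (t : nat) (x : R).

Lemma dev_min_le (F : 'I_(ndev p) -> R) m : (forall k, 0 <= F k) ->
  dev_min F <= F m.
Proof.
move=> F0; apply: ge_inf; last by exists m.
by exists 0 => _ [k _ <-].
Qed.

Lemma le_dev_min (F : 'I_(ndev p) -> R) a : (forall k, a <= F k) ->
  a <= dev_min F.
Proof.
move=> aF; apply: lb_le_inf; last by move=> _ [k _ <-].
by exists (F (Ordinal (ndev_ge1 p))), (Ordinal (ndev_ge1 p)).
Qed.

Lemma cabs_ge0 (z : R[i]) : 0 <= cabs z.
Proof. by case: z => a b; exact: sqrtr_ge0. Qed.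

Lemma batch_size_gt0 m : 0 < (batch_size m)%:R :> R.
Proof. by rewrite ltr0n batch_size_ge1. Qed.

Lemma data_size_gt0 m : 0 < (data_size m)%:R :> R.
Proof.
by rewrite ltr0n (leq_trans (batch_size_ge1 m) (batch_le_data m)).
Qed.

Lemma rate_gt0 m : 0 < rate m.
Proof. by rewrite divr_gt0 ?batch_size_gt0 ?data_size_gt0. Qed.

Lemma rate_le1 m : rate m <= 1.
Proof. by rewrite ler_pdivrMr ?data_size_gt0// mul1r ler_nat batch_le_data. Qed.

Lemma kfac_ge1 m : 1 <= kfac m.
Proof.
rewrite -[leLHS]sqrtr1; apply: ler_wsqrtr.
by rewrite lerDl divr_ge0 ?subr_ge0 ?rate_le1// ltW ?batch_size_gt0.
Qed.

Lemma kfac_le2 m : kfac m <= 2.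
Proof.
rewrite -[leRHS]ger0_norm// -sqrtr_sqr; apply: ler_wsqrtr.
have : (1 - rate m) / (batch_size m)%:R <= 1.
  rewrite ler_pdivrMr ?batch_size_gt0// mul1r.
  apply: (@le_trans _ _ 1); first by rewrite gerBl ltW ?rate_gt0.
  by rewrite ler1n batch_size_ge1.
lra.
Qed.

Lemma cabs_ge_lb m t : h_lb <= cabs (h m t).
Proof.
have /andP[hl _] := h_bounds t; apply: (le_trans hl).
by apply: (dev_min_le (F := fun m => cabs (h m t))) => k; exact: cabs_ge0.
Qed.

(** [kfac] lies between 1 and 2, so dividing by it costs at most a factor 2. *)
Lemma hmin_ge t : h_lb / 2 <= hmin h t.
Proof.
apply: le_dev_min => m; apply: ler_pM.
- exact: ltW.
- by rewrite invr_ge0.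
- exact: cabs_ge_lb.
- rewrite lef_pV2 ?posrE ?kfac_le2//.
  exact: (lt_le_trans ltr01 (kfac_ge1 m)).
Qed.

Lemma hmin_gt0 t : 0 < hmin h t.
Proof. by apply: lt_le_trans (hmin_ge t); rewrite divr_gt0. Qed.

Lemma hmin_le t : hmin h t <= h_ub.
Proof.
have /andP[_ hu] := h_bounds t; apply: le_trans hu.
apply: le_dev_min => m.
have k0 : 0 < kfac m by exact: (lt_le_trans ltr01 (kfac_ge1 m)).
apply: (@le_trans _ _ (cabs (h m t) / kfac m)).
  apply: (dev_min_le (F := fun m => cabs (h m t) / kfac m)) => k.
  by rewrite divr_ge0 ?cabs_ge0// (le_trans ler01) ?kfac_ge1.
by rewrite ler_pdivrMr// ler_peMr ?cabs_ge0 ?kfac_ge1.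
Qed.

(** The sum is a binomial average of exponentials whose exponents are nonnegative, as k^2 >= k for
    integers, and largest at k = a. Its logarithm is therefore between 0 and a (a - 1) / (2 s^2),
    and the prefactor cancels a - 1. *)
Lemma rho_bounds (a : nat) (q s : R) : (1 < a)%N -> 0 <= q <= 1 -> 0 < s ->
  0 <= rho a q s <= a%:R / (2 * s ^+ 2).
Proof.
move=> a1 /andP[q0 q1] s0.
have a10 : 0 < a%:R - 1 :> R by rewrite subr_gt0 ltr1n.
have s20 : 0 < 2 * s ^+ 2 by rewrite mulr_gt0// exprn_gt0.
pose b (k : 'I_a.+1) : R := 'C(a, k)%:R * (1 - q) ^+ (a - k) * q ^+ k.
have b0 k : 0 <= b k by rewrite !mulr_ge0 ?exprn_ge0 ?subr_ge0.
have sb : \sum_(k < a.+1) b k = 1.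
  have -> : 1 = ((1 - q) + q) ^+ a by rewrite subrK expr1n.
  rewrite exprDn; apply: eq_bigr => k _.
  by rewrite -[RHS]mulr_natl mulrA.
pose e (k : nat) : R := (k%:R ^+ 2 - k%:R) / (2 * s ^+ 2).
have e0 k : 0 <= e k.
  rewrite divr_ge0 ?(ltW s20)// subr_ge0 expr2 -natrM ler_nat.
  by case: k => // k; rewrite leq_pmulr.
have ea (k : 'I_a.+1) : e k <= e a.
  rewrite ler_wpM2r ?invr_ge0 ?(ltW s20)//.
  have ka : k%:R <= a%:R :> R by rewrite ler_nat -ltnS.
  case: (posnP k) => [->|k0].
    by rewrite expr0n subr0 subr_ge0 expr2 -natrM ler_nat leq_pmulr// ltnW.
  have k1 : 1 <= k%:R :> R by rewrite ler1n.
  by nra.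
rewrite /rho; set S := \sum_(k < a.+1) _.
have SE : S = \sum_(k < a.+1) b k * expR (e k) by [].
have S1 : 1 <= S.
  rewrite SE -sb; apply: ler_sum => k _; rewrite ler_peMr//.
  by rewrite -expR0 ler_expR.
have S2 : S <= expR (e a).
  rewrite SE -[leRHS]mul1r -sb mulr_suml; apply: ler_sum => k _.
  by rewrite ler_wpM2l// ler_expR.
have S0 : 0 < S by exact: lt_le_trans S1.
apply/andP; split.
  by rewrite mulr_ge0 ?invr_ge0 ?(ltW a10)// ln_ge0.
have lnS : ln S <= e a by rewrite -(expRK (e a)) ler_ln ?posrE ?expR_gt0.
rewrite ler_pdivrMl//; apply: (le_trans lnS).
by rewrite [leRHS]mulrA /e ler_wpM2r ?invr_ge0 ?(ltW s20)// mulrBl mul1r -expr2.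
Qed.

Lemma xmax_gt0 : 0 < xmax p.
Proof.
apply: divr_gt0; last by rewrite exprn_gt0 ?grad_bound_gt0.
apply: mulr_gt0; last by rewrite exprn_gt0 ?ltr0n ?ndev_ge1.
by apply: mulr_gt0; rewrite ?pow_max_gt0 ?ltr0n ?model_dim_ge1.
Qed.

Lemma sum_privacy_bounds : exists2 c : R, 0 <= c & forall t x, 0 < x <= xmax p ->
  0 <= \sum_(m < ndev p) privacy h m t x <= c.
Proof.
pose B m : R := (ndev p)%:R * (batch_size m)%:R * noise_std p.
have B0 m : 0 < B m.
  by rewrite !mulr_gt0 ?batch_size_gt0 ?noise_std_gt0// ltr0n ndev_ge1.
(* The bound of [rho_bounds] at the smallest possible noise multiplier, that is at [x = xmax p] with
   [hmin] replaced by [h_ub]. *)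
pose cm m : R := (rdp_order p)%:R / 2 *
  (2 * xmax p * grad_bound p ^+ 2 * h_ub ^+ 2 / B m ^+ 2).
have x0 := xmax_gt0.
have cm0 m : 0 <= cm m.
  apply: mulr_ge0; first by rewrite divr_ge0.
  apply: divr_ge0; last exact: sqr_ge0.
  apply: mulr_ge0; last exact: sqr_ge0.
  by apply: mulr_ge0; [rewrite mulr_ge0 // ltW|exact: sqr_ge0].
have pm m t x : 0 < x <= xmax p -> 0 <= privacy h m t x <= cm m.
  move=> /andP[xp xM].
  have s0 : 0 < eff_std h m t x.
    rewrite divr_gt0// ?B0// !mulr_gt0 ?sqrtr_gt0 ?mulr_gt0 ?grad_bound_gt0//.
    exact: hmin_gt0.
  have := rho_bounds (rdp_order_gt1 p) _ s0 => /(_ (rate m)).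
  rewrite (ltW (rate_gt0 m)) rate_le1 => /(_ isT)/andP[-> /le_trans->//].
  rewrite /cm invfM mulrA ler_wpM2l ?divr_ge0// /eff_std -/(B m).
  rewrite expr_div_n invf_div ler_wpM2r ?invr_ge0 ?exprn_ge0 ?(ltW (B0 m))//.
  rewrite !exprMn sqr_sqrtr ?mulr_ge0 ?(ltW xp)//.
  apply: ler_pM.
  - by rewrite mulr_ge0 ?sqr_ge0// mulr_ge0// ltW.
  - exact: sqr_ge0.
  - by rewrite ler_wpM2r ?sqr_ge0// ler_wpM2l.
  - rewrite lerXn2r ?nnegrE ?hmin_le// ?(ltW (hmin_gt0 t))//.
    exact: le_trans (ltW (hmin_gt0 t)) (hmin_le t).
exists (\sum_(m < ndev p) cm m); first by apply: sumr_ge0.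
move=> t x xr; apply/andP; split.
  by apply: sumr_ge0 => m _; case/andP: (pm m t x xr).
by apply: ler_sum => m _; case/andP: (pm m t x xr).
Qed.

End channel_bounds.

(** * AdaScale: regret and sum of the inverse scaling factors *)

Section adascale_bounds.
Context (R : realType) (p : ota_params R) (h : 'I_(ndev p) -> nat -> R[i]).
Context (h_lb h_ub c : R).
Hypothesis h_lb_gt0 : 0 < h_lb.
Hypothesis h_bounds : forall t, h_lb <= dev_min (fun m => cabs (h m t)) <= h_ub.
Hypothesis c_ge0 : 0 <= c.
Hypothesis privacy_le : forall t x, 0 < x <= xmax p ->
  0 <= \sum_(m < ndev p) privacy h m t x <= c.
Context (T : nat) (V : R) (x : nat -> R).
Hypothesis T_gt0 : (0 < T)%N.
Hypothesis V_gt0 : 0 < V.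
Hypothesis x_adascale : adascale h V T x.
Local Notation nu := (noise_budget p).

Lemma adascale_range t : (t < T)%N -> 0 < x t <= xmax p.
Proof. by move=> /x_adascale[]. Qed.

Lemma excess_noise_ge0 t y : 0 < y <= xmax p -> 0 <= excess_noise h t y.
Proof.
move=> /andP[y0 yM]; apply: mulr_ge0.
  by rewrite divr_ge0 ?sqr_ge0// mulr_ge0 ?sqr_ge0.
by rewrite subr_ge0 ler_pM2l// lef_pV2 ?posrE// xmax_gt0.
Qed.

Lemma adascale_objectiveE W Q t y : adascale_objective h W Q t y =
  W * (\sum_(m < ndev p) privacy h m t y) + Q * excess_noise h t y
  + 2^-1 * excess_noise h t y ^+ 2.
Proof. by rewrite /adascale_objective -exprMn. Qed.

Lemma adascale_cmp t y : (t < T)%N -> 0 < y <= xmax p ->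
  V * (\sum_(m < ndev p) privacy h m t (x t))
  + queue h x t * excess_noise h t (x t) + 2^-1 * excess_noise h t (x t) ^+ 2 <=
  V * (\sum_(m < ndev p) privacy h m t y)
  + queue h x t * excess_noise h t y + 2^-1 * excess_noise h t y ^+ 2.
Proof.
by move=> /x_adascale[_ xmin] /xmin; rewrite !adascale_objectiveE.
Qed.

(* Full power makes the excess noise vanish, so only the privacy term, which
   is bounded, remains on the other side of the comparison. *)
Lemma adascale_penalty_le t : (t < T)%N ->
  V * (\sum_(m < ndev p) privacy h m t (x t))
  + queue h x t * excess_noise h t (x t) + 2^-1 * excess_noise h t (x t) ^+ 2 <=
  V * c.
Proof.
move=> tT; have xM : 0 < xmax p <= xmax p by rewrite xmax_gt0 lexx.
apply: (le_trans (adascale_cmp tT xM)).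
have -> : excess_noise h t (xmax p) = 0 by rewrite /excess_noise subrr mulr0.
rewrite expr0n !mulr0 !addr0 ler_wpM2l ?(ltW V_gt0)//.
by case/andP: (privacy_le t xM).
Qed.

Lemma adascale_regret (xs : nat -> R) : offline_feasible h T xs ->
  T%:R^-1 * (\sum_(t < T) \sum_(m < ndev p)
    (privacy h m t (x t) - privacy h m t (xs t))) <=
  nu * Num.sqrt (2 * c * (T%:R / V)) + nu ^+ 2 * (T%:R / V).
Proof.
move=> [sxs rxs].
have T0 : 0 < T%:R :> R by rewrite ltr0n.
have T1 : 1 <= T%:R :> R by rewrite ler1n.
have nu0 := noise_budget_ge0 p.
have := @drift_plus_penalty_regret R T V c nu
  (fun t => \sum_(m < ndev p) privacy h m t (x t)) (queue h x)
  (fun t => excess_noise h t (x t)) V_gt0 c_ge0 nu0 erefl (fun=> erefl).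
move=> /(_ (fun t tT => excess_noise_ge0 t (adascale_range tT))).
move=> /(_ _ adascale_penalty_le).
have F0 t : (t < T)%N -> 0 <= \sum_(m < ndev p) privacy h m t (x t).
  by move=> tT; case/andP: (privacy_le t (adascale_range tT)).
move=> /(_ F0 (fun t => \sum_(m < ndev p) privacy h m t (xs t))
  (fun t => excess_noise h t (xs t))).
move=> /(_ (fun t tT => excess_noise_ge0 t (rxs t tT))).
move=> /(_ (fun t tT => adascale_cmp tT (rxs t tT))).
rewrite -ler_pdivrMl// => /(_ sxs).
under eq_bigr do rewrite -sumrB.
set S := \sum_(t < T) _ => VS.
rewrite ler_pdivrMl// -(ler_pM2l V_gt0); apply: (le_trans VS).
have -> : Num.sqrt (2 * V * c * T%:R) = V * Num.sqrt (2 * c * (T%:R / V)).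
  rewrite -{2}(ger0_norm (ltW V_gt0)) -sqrtr_sqr -sqrtrM ?sqr_ge0//.
  by congr Num.sqrt; field; rewrite gt_eqF.
set q := Num.sqrt _.
have -> : V * (T%:R * (nu * q + nu ^+ 2 * (T%:R / V))) =
  V * q * (T%:R * nu) + (T%:R * nu) ^+ 2 by field; rewrite gt_eqF.
(* As T >= 1, the drift remainder is absorbed into the comparator's quadratic term, and the two
   halves add up to one. *)
have : T%:R * nu ^+ 2 <= (T%:R * nu) ^+ 2.
  by rewrite exprMn ler_wpM2r ?sqr_ge0// expr2 ler_peMl ?ler0n.
lra.
Qed.

(** 1/eta_t is affine in the excess noise: it equals the excess noise divided by d sigma_n^2, plus
    its value at full power. The sum of the arrivals is at most Q_T + T nu, and the full-power part
    is bounded by the lower bound on [hmin]. *)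
Lemma adascale_sum_inv_eta :
  \sum_(t < T) (x t * hmin h t ^+ 2)^-1 <=
  (Num.sqrt (2 * V * c * T%:R) + T%:R * nu) /
    ((model_dim p)%:R * noise_std p ^+ 2) +
  T%:R * (xmax p * (h_lb / 2) ^+ 2)^-1.
Proof.
have d0 : 0 < (model_dim p)%:R :> R by rewrite ltr0n model_dim_ge1.
have s0 := noise_std_gt0 p; have nu0 := noise_budget_ge0 p.
have x0 := xmax_gt0 p.
have T1 : (T <= T)%N by [].
pose u t := excess_noise h t (x t).
have F0 t : (t < T)%N -> 0 <= \sum_(m < ndev p) privacy h m t (x t).
  by move=> tT; case/andP: (privacy_le t (adascale_range tT)).
have Qle := @queue_le R T V c nu
  (fun t => \sum_(m < ndev p) privacy h m t (x t)) (queue h x) u V_gt0 c_ge0 nu0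
  erefl (fun=> erefl) (fun t tT => excess_noise_ge0 t (adascale_range tT)) F0
  adascale_penalty_le T T1.
have sumu : \sum_(t < T) u t <= queue h x T + T%:R * nu.
  by apply: sum_arrivals_le.
apply: (@le_trans _ _ ((\sum_(t < T) u t) /
    ((model_dim p)%:R * noise_std p ^+ 2) +
    \sum_(t < T) (xmax p * (h_lb / 2) ^+ 2)^-1)); last first.
  rewrite sumr_const card_ord -[X in _ + X <= _]mulr_natl lerD2r ler_wpM2r//.
    by rewrite invr_ge0 mulr_ge0 ?sqr_ge0.
  by apply: (le_trans sumu); rewrite lerD2r.
rewrite mulr_suml -big_split; apply: ler_sum => t _ /=.
have hm0 := hmin_gt0 h_lb_gt0 h_bounds t.
have /andP[xt0 _] := adascale_range (ltn_ord t).
have -> : (x t * hmin h t ^+ 2)^-1 =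
    u t / ((model_dim p)%:R * noise_std p ^+ 2) + (xmax p * hmin h t ^+ 2)^-1.
  rewrite /u /excess_noise; field.
  by rewrite !gt_eqF.
have hx : 0 < xmax p * hmin h t ^+ 2.
  by apply: mulr_gt0 => //; rewrite exprn_gt0.
have lx : 0 < xmax p * (h_lb / 2) ^+ 2.
  by apply: mulr_gt0 => //; rewrite exprn_gt0// divr_gt0.
rewrite lerD2l lef_pV2 ?posrE//.
rewrite ler_pM2l// lerXn2r ?nnegrE ?(ltW hm0)//.
  by rewrite divr_ge0 ?ltW.
exact: (hmin_ge h_lb_gt0 h_bounds).
Qed.

End adascale_bounds.

(** * Negative powers of the horizon, and inclusion probabilities of a batch *)

Lemma cvg_natr_powRN (R : realType) (a : R) : 0 < a ->
  (T%:R `^ (- a)) @[T --> \oo] --> (0 : R).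
Proof.
move=> a0; apply/cvgrPdist_lt => e e0.
near=> T.
have T0 : 0 < (T%:R : R) by rewrite ltr0n; near: T; exact: nbhs_infty_gt.
rewrite sub0r normrN ger0_norm ?powR_ge0// powRN.
rewrite invf_plt ?posrE ?powR_gt0//.
have -> : e^-1 = (e^-1 `^ a^-1) `^ a.
  by rewrite -powRrM mulVf ?gt_eqF// powRr1// invr_ge0 ltW.
rewrite gt0_ltr_powR ?nnegrE ?powR_ge0 ?(ltW T0)//.
by near: T; exact: nbhs_infty_gtr.
Unshelve. all: by end_near. Qed.

(** Expand the product of the [F k + G k] over subsets, where [G] is 1 - q except for [G i = 0]:
    subsets missing [i] vanish, and the product itself has the single factor q different from 1 - q
    + q. *)
Lemma sum_batch_weights (R : realType) (n : nat) (q : R) (i : 'I_n) :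
  \sum_(S : {set 'I_n} | i \in S) \prod_(k < n) (if k \in S then q else 1 - q)
  = q.
Proof.
pose F (k : 'I_n) := q.
pose G (k : 'I_n) := if k == i then 0 else 1 - q.
have := @bigA_distr R 0 1 *%R +%R _ F G.
rewrite (bigD1 i) //= big1 => [|k ki]; last first.
  by rewrite /F /G (negbTE ki) addrC subrK.
rewrite /F /G eqxx addr0 mulr1 => qE; rewrite [RHS]qE.
rewrite [RHS](bigID (fun S : {set 'I_n} => i \in S)) /= [X in _ = _ + X]big1.
  rewrite addr0; apply: eq_bigr => S iS; apply: eq_bigr => k _.
  by case: ifPn => // kS; have [ki|//] := eqVneq k i; rewrite ki iS in kS.
move=> S iS; rewrite (bigD1 i)//= (negbTE iS) eqxx mul0r//.
Qed.

(** * Moments under independence and conditioning on generated sigma-algebras *)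

Section generated_sigma_algebras.
Context d (T : measurableType d) (R : realType) (P : probability T R).

Lemma sigma_measurable_preimage (G : set (set T)) (f : T -> R) :
  measurable_fun (setT : set (g_sigma_algebraType G)) f ->
  forall B, measurable B -> <<s G>> (f @^-1` B).
Proof. by move=> mf B mB; have := mf measurableT B mB; rewrite setTI. Qed.

Lemma sigma_measurable_sub (G H : set (set T)) (f : T -> R) : G `<=` H ->
  measurable_fun (setT : set (g_sigma_algebraType G)) f ->
  measurable_fun (setT : set (g_sigma_algebraType H)) f.
Proof.
move=> GH mf mT B mB; rewrite setTI.
exact: (sub_sigma_algebra2 GH) (sigma_measurable_preimage mf mB).
Qed.

Lemma vec_sys_measurable n (X : T -> 'rV[R]_n) (G : set (set T)) j :
  vec_sys X `<=` G ->
  measurable_fun (setT : set (g_sigma_algebraType G)) (fun o => X o 0 j).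
Proof.
move=> XG mT B mB; rewrite setTI; apply: sub_sigma_algebra; apply: XG.
by exists j => //; exists B => //; rewrite setTI.
Qed.

Lemma Rintegral_mul_sigma_independent (F G : set (set T)) (X Y : T -> R) :
  square_integrable P X -> square_integrable P Y ->
  independent_of P <<s F>> <<s G>> ->
  measurable_fun (setT : set (g_sigma_algebraType F)) X ->
  measurable_fun (setT : set (g_sigma_algebraType G)) Y ->
  \int[P]_o (X o * Y o) = \int[P]_o X o * \int[P]_o Y o.
Proof.
move=> sX sY FG mX mY; apply: Rintegral_mul_independent => // B C mB mC.
by apply: FG; exact: sigma_measurable_preimage.
Qed.

Lemma Rintegral_mul_cond_mean0 (F : set (set T)) (phi z : T -> R) :
  square_integrable P phi -> square_integrable P z ->
  measurable_fun (setT : set (g_sigma_algebraType F)) phi ->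
  cond_expectation P <<s F>> z (cst 0) ->
  \int[P]_o (phi o * z o) = 0.
Proof.
move=> sphi sz mphi [_ _ _ hz]; apply: Rintegral_mul_eq0 => // B mB.
rewrite /Rintegral -(hz _ (sigma_measurable_preimage mphi mB)).
by rewrite integral0_eq.
Qed.

(** A marginal of the joint law: all the other sets are taken to be the whole line, so their factors
    are 1. *)
Lemma complex_gaussian_re_law n (s : R) (N : T -> 'rV[R[i]]_n) j B :
  s != 0 -> complex_gaussian P s N -> measurable B ->
  P ((fun o => complex.Re (N o 0 j)) @^-1` B) =
  normal_prob 0 (s / Num.sqrt 2) B.
Proof.
move=> s0 [_ _ law] mB.
pose A k := if k == j then B else setT.
have mA k : measurable (A k) by rewrite /A; case: ifP.
have := law A (fun=> setT) mA (fun=> measurableT).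
rewrite (_ : [set o | _] = (fun o => complex.Re (N o 0 j)) @^-1` B); last first.
  rewrite /A; apply/seteqP; split => [w /(_ j)[]|w /= Bw k].
    by rewrite eqxx.
  by split => //; have [->|] := eqVneq k j.
move=> ->; rewrite /A.
have NT : normal_prob 0 (s / Num.sqrt 2) setT = 1%E.
  exact: (@probability_setT _ _ _ (normal_prob 0 (s / Num.sqrt 2))).
rewrite (bigD1 j)//= eqxx [X in (_ * X * _)%E]NT mule1 big1 ?mule1//.
by move=> k kj; rewrite (negbTE kj) [X in (X * X)%E]NT mule1.
Qed.

End generated_sigma_algebras.

Lemma normr_coord_le_enorm (R : realType) n (v : 'rV[R]_n) j : `|v 0 j| <= enorm v.
Proof.
rewrite -sqrtr_sqr; apply: ler_wsqrtr; rewrite /dotv (bigD1 j)//= -expr2.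
by rewrite lerDl; apply: sumr_ge0 => k _; rewrite -expr2 sqr_ge0.
Qed.

Lemma enorm_sqr (R : realType) n (v : 'rV[R]_n) :
  enorm v ^+ 2 = \sum_(j < n) v 0 j ^+ 2.
Proof.
rewrite sqr_sqrtr /dotv; first by apply: eq_bigr => j _; rewrite -expr2.
by apply: sumr_ge0 => j _; rewrite -expr2 sqr_ge0.
Qed.

Section finite_valued.
Context d (T : measurableType d) (R : realType) (S : finType) (X : T -> S).

Lemma fin_sys_measurable (f : S -> R) :
  measurable_fun (setT : set (g_sigma_algebraType (fin_sys X)))
    (fun o => f (X o)).
Proof.
move=> mT B mB; rewrite setTI; apply: sub_sigma_algebra.
by exists (f @^-1` B) => //; rewrite setTI.
Qed.

Lemma fin_valued_measurable (f : S -> R) :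
  (forall s, measurable (X @^-1` [set s])) ->
  measurable_fun setT (fun o => f (X o)).
Proof.
move=> mX mT B mB; rewrite setTI.
rewrite (_ : _ @^-1` B = \bigcup_(s in f @^-1` B) X @^-1` [set s]).
  by apply: fin_bigcup_measurable => // s _; exact: mX.
apply/seteqP; split => [w /= Bw|w [s /= Bs ->]//].
by exists (X w).
Qed.

End finite_valued.

(** * One run of FedSGD over a fixed horizon *)

Section fedsgd_run.
Context (R : realType) (p : ota_params R).
Local Notation M := (ndev p).
Local Notation d := (model_dim p).
Local Notation n := (@data_size R p).
Context (dU dO : measure_display) (U : measurableType dU)
  (O : measurableType dO).
Context (pdata : 'I_M -> probability (U * O)%type R).
Context (c : 'I_M -> R) (l : 'rV[R]_d -> U * O -> R).
Context (h : 'I_M -> nat -> R[i]).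
Context (dOm : measure_display) (Om : measurableType dOm).
Context (P : probability Om R) (w : nat -> Om -> 'rV[R]_d).
Context (xi : nat -> forall m : 'I_M, 'I_(n m) -> {RV P >-> (U * O)%type}).
Context (batch : nat -> forall m : 'I_M, Om -> {set 'I_(n m)}).
Context (noise : nat -> Om -> 'rV[R[i]]_d).
Context (lam : R) (eta : nat -> R) (w0 : 'rV[R]_d) (T : nat) (A1 A2 : R).
Hypothesis losses : losses_well_defined pdata c l.
Hypothesis run : ota_fedsgd c l h w xi batch noise lam eta w0 T.
Hypothesis zbound : sample_noise_bounded pdata c l w xi A1 A2 T.
Hypothesis h_neq0 : forall m t, h m t != 0.
Hypothesis eta_gt0 : forall t, (t < T)%N -> 0 < eta t.
Local Notation sgrad := (sample_grad c l w xi).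
Local Notation gloc t m o := (grad (local_loss pdata c l m) (w t o)).
Local Notation gglob t o := (grad (global_loss pdata c l) (w t o)).

Definition mean_batch_grad (t : nat) (o : Om) : 'rV[R]_d :=
  M%:R^-1 *: \sum_(m < M) batch_grad c l w xi batch t m o.

Definition re_noise (t : nat) (j : 'I_d) (o : Om) : R :=
  complex.Re (noise t o 0 j).

Definition step (t : nat) (j : 'I_d) (o : Om) : R :=
  mean_batch_grad t o 0 j + (Num.sqrt (eta t))^-1 * re_noise t j o.

Definition in_batch (t : nat) (m : 'I_M) (i : 'I_(n m)) (o : Om) : R :=
  (i \in batch t m o)%:R.

(** The precoding inverts the channel: [h m t] cancels, so apart from the receiver noise the
    received vector is real, and the real part discards nothing but the imaginary noise. *)
Lemma update_coord t j o : (t < T)%N ->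
  w t.+1 o 0 j = w t o 0 j - lam * step t j o.
Proof.
move=> tT; rewrite (fedsgd_update run o tT).
set r := received c l h w xi batch noise eta t o.
have M0 : M%:R != 0 :> R[i] by rewrite pnatr_eq0 -lt0n ndev_ge1.
have M0' : M%:R != 0 :> R by rewrite pnatr_eq0 -lt0n ndev_ge1.
have s0 : Num.sqrt (eta t) != 0 by rewrite sqrtr_eq0 -ltNge eta_gt0.
have rE : r 0 j =
    real_complex R (Num.sqrt (eta t) * mean_batch_grad t o 0 j) + noise t o 0 j.
  rewrite /r /received !mxE; congr (_ + _).
  rewrite summxE summxE !mulr_sumr raddf_sum /=; apply: eq_bigr => m _.
  rewrite !mxE !rmorphM fmorphV rmorph_nat; field.
  by rewrite M0 h_neq0 pnatr_eq0 -lt0n batch_size_ge1.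
move: r rE => r rE; rewrite !mxE rE; congr (_ - _).
rewrite /step /re_noise; case: (noise t o 0 j) => a b /=.
by field.
Qed.

Lemma batch_grad_coord t m j o : batch_grad c l w xi batch t m o 0 j =
  (batch_size m)%:R^-1 * \sum_(i < n m) in_batch t i o * sgrad t i o 0 j.
Proof.
rewrite !mxE summxE big_mkcond; congr (_ * _); apply: eq_bigr => i _.
by rewrite /in_batch; case: ifP => _; rewrite ?mul1r ?mul0r.
Qed.

Lemma mean_batch_grad_coord t j o : mean_batch_grad t o 0 j =
  M%:R^-1 * \sum_(m < M) (batch_size m)%:R^-1 *
    \sum_(i < n m) in_batch t i o * sgrad t i o 0 j.
Proof.
by rewrite mxE summxE; congr (_ * _); apply: eq_bigr => m _;
  rewrite batch_grad_coord.
Qed.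

Lemma measurable_in_batch t m (i : 'I_(n m)) : (t < T)%N ->
  measurable_fun setT (in_batch t i).
Proof.
move=> tT.
apply: (fin_valued_measurable (fun S : {set 'I_(n m)} => (i \in S)%:R : R)).
by move=> S; exact: (fedsgd_batch_measurable run).
Qed.

Lemma square_integrable_in_batch t m (i : 'I_(n m)) : (t < T)%N ->
  square_integrable P (in_batch t i).
Proof.
move=> tT; apply: (@square_integrable_ae_bounded _ _ _ _ _ 1 _ _).1.
  exact: measurable_in_batch.
by apply: aeW => o; rewrite /in_batch; case: (_ \in _); rewrite ?normr1 ?normr0.
Qed.

Lemma measurable_mean_batch_grad t j : (t < T)%N ->
  measurable_fun setT (fun o => mean_batch_grad t o 0 j).
Proof.
move=> tT; under eq_fun do rewrite mean_batch_grad_coord.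
apply: measurable_funM => //; apply: measurable_sum => m.
apply: measurable_funM => //; apply: measurable_sum => i.
apply: measurable_funM; first exact: measurable_in_batch.
exact: (fedsgd_grad_measurable run).
Qed.

Lemma measurable_re_noise t j : (t < T)%N -> measurable_fun setT (re_noise t j).
Proof.
move=> tT; have [mre _ _] := fedsgd_noise_law run tT.
by have := mre j; apply: eq_measurable_fun => o _; rewrite mxE.
Qed.

Lemma differentiable_global_loss x : differentiable (global_loss pdata c l) x.
Proof.
have [_ dl _] := losses.
rewrite (_ : global_loss pdata c l =
  M%:R^-1 \*: \sum_(m < M) local_loss pdata c l m); last first.
  by apply/funext => y; rewrite /global_loss /= fct_sumE.
apply: differentiableZ; apply: differentiable_sum => m; exact: dl.
Qed.

Lemma grad_global_loss x j : grad (global_loss pdata c l) x 0 j =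
  M%:R^-1 * \sum_(m < M) grad (local_loss pdata c l m) x 0 j.
Proof.
have [_ dl _] := losses; rewrite mxE.
rewrite (_ : global_loss pdata c l =
  M%:R^-1 \*: \sum_(m < M) local_loss pdata c l m); last first.
  by apply/funext => y; rewrite /global_loss /= fct_sumE.
have dv m : derivable (local_loss pdata c l m) x (delta_mx 0 j).
  exact: diff_derivable.
rewrite deriveZ; last by apply: derivable_sum => m.
congr (_ * _); rewrite derive_sum//; apply: eq_bigr => m _.
by rewrite mxE.
Qed.

Lemma ae_sample_grad_coord_le t m (i : 'I_(n m)) j : (t < T)%N ->
  {ae P, forall o, `|sgrad t i o 0 j| <= grad_bound p}.
Proof.
move=> tT; apply: filterS (fedsgd_grad_bound run i tT) => o.
exact: le_trans (normr_coord_le_enorm _ _).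
Qed.

Lemma square_integrable_sample_grad t m (i : 'I_(n m)) j : (t < T)%N ->
  square_integrable P (fun o => sgrad t i o 0 j).
Proof.
move=> tT; apply: (@square_integrable_ae_bounded _ _ _ _ _ (grad_bound p) _ _).1.
  exact: (fedsgd_grad_measurable run).
exact: ae_sample_grad_coord_le.
Qed.

(** Having a conditional expectation includes integrability, here of the squared norm, which
    dominates the square of each coordinate. *)
Lemma square_integrable_sample_noise t m (i : 'I_(n m)) j : (t < T)%N ->
  square_integrable P (fun o => sample_noise pdata c l w xi t i o 0 j).
Proof.
move=> tT; have [cz [Y [iz _ _ _] _]] := zbound i tT.
have [/integrableP[/measurable_EFinP mz _] _ _ _] := cz j.
apply: square_integrable_domin mz _ iz => o.
rewrite enorm_sqr (bigD1 j)//= lerDl.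
by apply: sumr_ge0 => k _; exact: sqr_ge0.
Qed.

Lemma local_grad_coord t m (i : 'I_(n m)) j o : gloc t m o 0 j =
  sgrad t i o 0 j - sample_noise pdata c l w xi t i o 0 j.
Proof. by rewrite /sample_noise !mxE subKr. Qed.

(** Any one sample of the device exhibits the local gradient as sample gradient minus sample noise;
    a sample exists because the data size is at least the batch size, hence at least 1. *)
Lemma square_integrable_local_grad t m j : (t < T)%N ->
  square_integrable P (fun o => gloc t m o 0 j).
Proof.
move=> tT.
have n0 : (0 < n m)%N by rewrite (leq_trans (batch_size_ge1 m))// batch_le_data.
have := square_integrableB
  (square_integrable_sample_grad (Ordinal n0) j tT)
  (square_integrable_sample_noise (Ordinal n0) j tT).
by under eq_fun do rewrite -local_grad_coord.
Qed.

Lemma global_grad_coord t j o :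
  gglob t o 0 j = M%:R^-1 * \sum_(m < M) gloc t m o 0 j.
Proof. exact: grad_global_loss. Qed.

Lemma square_integrable_global_grad t j : (t < T)%N ->
  square_integrable P (fun o => gglob t o 0 j).
Proof.
move=> tT; under eq_fun do rewrite global_grad_coord.
apply: square_integrableZ; apply: square_integrable_sum => m.
exact: square_integrable_local_grad.
Qed.

Lemma sigma_measurable_global_grad t j :
  measurable_fun (setT : set (g_sigma_algebraType (vec_sys (w t))))
    (fun o => gglob t o 0 j).
Proof.
apply: (@measurable_grad _ (g_sigma_algebraType (vec_sys (w t)))).
  by move=> k; exact: vec_sys_measurable.
exact: differentiable_global_loss.
Qed.

Lemma Rintegral_global_sample_grad t m (i : 'I_(n m)) j : (t < T)%N ->
  \int[P]_o (gglob t o 0 j * sgrad t i o 0 j) =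
  \int[P]_o (gglob t o 0 j * gloc t m o 0 j).
Proof.
move=> tT.
have sphi := square_integrable_global_grad j tT.
have sz := square_integrable_sample_noise i j tT.
have sg := square_integrable_local_grad m j tT.
transitivity (\int[P]_o (gglob t o 0 j * gloc t m o 0 j +
    gglob t o 0 j * sample_noise pdata c l w xi t i o 0 j)).
  apply: eq_Rintegral => o _.
  by rewrite (local_grad_coord t i) -mulrDr subrK.
rewrite RintegralD//; try exact: square_integrable_mul.
have [cz _] := zbound i tT.
by rewrite (Rintegral_mul_cond_mean0 sphi sz (sigma_measurable_global_grad (t := t) j)
  (cz j)) addr0.
Qed.

Lemma Rintegral_in_batch t m (i : 'I_(n m)) : (t < T)%N ->
  \int[P]_o in_batch t i o = rate m.
Proof.
move=> tT; pose B (S : {set 'I_(n m)}) := batch t m @^-1` [set S].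
have mB S : measurable (B S) by exact: (fedsgd_batch_measurable run).
have iB (S : {set 'I_(n m)}) : P.-integrable setT
    (EFin \o (fun o => (i \in S)%:R * \1_(B S) o)).
  by apply: integrable_scale; exact: integrable_indic.
transitivity (\int[P]_o \sum_(S : {set 'I_(n m)}) ((i \in S)%:R * \1_(B S) o)).
  apply: eq_Rintegral => o _; rewrite (bigD1 (batch t m o))//= big1.
    by rewrite addr0 indicE mem_set// mulr1.
  move=> S So; rewrite indicE memNset ?mulr0// => /= oS.
  by rewrite oS eqxx in So.
rewrite Rintegral_big_sum// -[RHS](sum_batch_weights (rate m) i) [RHS]big_mkcond.
apply: eq_bigr => S _; rewrite RintegralZl//; last exact: integrable_indic.
rewrite /Rintegral integral_indic// setIT [X in fine X](fedsgd_batch_law run S tT) /=.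
by case: ifP => _; rewrite ?mul1r ?mul0r.
Qed.

Lemma vec_sys_model_sub t : vec_sys (w t) `<=` model_grad_sys c l w xi t.
Proof. by move=> A; left. Qed.

Lemma vec_sys_sample_grad_sub t m (i : 'I_(n m)) :
  vec_sys (sgrad t i) `<=` model_grad_sys c l w xi t.
Proof. by move=> A; right; exists m => //; exists i. Qed.

Lemma square_integrable_global_sample_grad t m (i : 'I_(n m)) j : (t < T)%N ->
  square_integrable P (fun o => gglob t o 0 j * sgrad t i o 0 j).
Proof.
move=> tT; apply: (square_integrable_mul_ae_bounded
  (square_integrable_global_grad j tT)).
- exact: (fedsgd_grad_measurable run).
- exact: ae_sample_grad_coord_le.
Qed.

(** The product of global and sample gradient is taken as a single variable, measurable for
    [model_grad_sys]; independence of the batch then factors out the inclusion probability before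
    the sample noise is averaged away. *)
Lemma Rintegral_batch_term t m (i : 'I_(n m)) j : (t < T)%N ->
  \int[P]_o (in_batch t i o * (gglob t o 0 j * sgrad t i o 0 j)) =
  rate m * \int[P]_o (gglob t o 0 j * gloc t m o 0 j).
Proof.
move=> tT.
rewrite (@Rintegral_mul_sigma_independent _ _ _ P (fin_sys (batch t m))
  (model_grad_sys c l w xi t)).
- by rewrite Rintegral_in_batch// Rintegral_global_sample_grad.
- exact: square_integrable_in_batch.
- exact: square_integrable_global_sample_grad.
- exact: (fedsgd_batch_indep run).
- exact: (@fin_sys_measurable _ Om R _ (batch t m)
    (fun S : {set 'I_(n m)} => (i \in S)%:R : R)).
- apply: measurable_funM.
    exact: sigma_measurable_sub (@vec_sys_model_sub t)
      (sigma_measurable_global_grad (t := t) j).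
  exact: (vec_sys_measurable _ (@vec_sys_sample_grad_sub t m i)).
Qed.

Lemma Rintegral_global_mean_batch_grad t j : (t < T)%N ->
  \int[P]_o (gglob t o 0 j * mean_batch_grad t o 0 j) =
  \int[P]_o (gglob t o 0 j ^+ 2).
Proof.
move=> tT.
have ib m (i : 'I_(n m)) : P.-integrable setT
    (EFin \o (fun o => in_batch t i o * (gglob t o 0 j * sgrad t i o 0 j))).
  apply: square_integrable_mul; first exact: square_integrable_in_batch.
  exact: square_integrable_global_sample_grad.
have il m : P.-integrable setT
    (EFin \o (fun o => gglob t o 0 j * gloc t m o 0 j)).
  apply: square_integrable_mul; first exact: square_integrable_global_grad.
  exact: square_integrable_local_grad.
pose Fm m o := (batch_size m)%:R^-1 *
    \sum_(i < n m) (in_batch t i o * (gglob t o 0 j * sgrad t i o 0 j)).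
have iF m : P.-integrable setT (EFin \o Fm m).
  by apply: integrable_scale; apply: integrable_big_sum.
transitivity (\int[P]_o (M%:R^-1 * \sum_(m < M) Fm m o)).
  apply: eq_Rintegral => o _; rewrite mean_batch_grad_coord mulrCA; congr (_ * _).
  rewrite mulr_sumr; apply: eq_bigr => m _; rewrite mulrCA; congr (_ * _).
  by rewrite mulr_sumr; apply: eq_bigr => i _; rewrite mulrCA.
rewrite RintegralZl//; last exact: integrable_big_sum.
rewrite Rintegral_big_sum//.
transitivity (\int[P]_o (M%:R^-1 * \sum_(m < M) (gglob t o 0 j * gloc t m o 0 j)));
  last first.
  apply: eq_Rintegral => o _; rewrite -mulr_sumr mulrCA -global_grad_coord.
  by rewrite expr2.
rewrite RintegralZl//; last exact: integrable_big_sum.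
rewrite Rintegral_big_sum//; congr (_ * _); apply: eq_bigr => m _.
rewrite RintegralZl//; last exact: integrable_big_sum.
rewrite Rintegral_big_sum//.
under eq_bigr do rewrite Rintegral_batch_term//.
(* Unbiasedness: n_m samples, each kept with probability B_m / n_m and weighted by 1 / B_m, have
   expected total weight 1. *)
rewrite sumr_const card_ord -mulr_natl /rate; field.
by rewrite !gt_eqF ?data_size_gt0 ?batch_size_gt0.
Qed.

Let noise_sd_gt0 : 0 < noise_std p / Num.sqrt 2.
Proof. by rewrite divr_gt0 ?noise_std_gt0// sqrtr_gt0. Qed.

Lemma re_noise_law t j B : (t < T)%N -> measurable B ->
  P (re_noise t j @^-1` B) = normal_prob 0 (noise_std p / Num.sqrt 2) B.
Proof.
move=> tT mB; apply: (complex_gaussian_re_law j _ (fedsgd_noise_law run tT) mB).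
by rewrite gt_eqF// noise_std_gt0.
Qed.

Lemma square_integrable_re_noise t j : (t < T)%N ->
  square_integrable P (re_noise t j).
Proof.
move=> tT; apply: (square_integrable_normal noise_sd_gt0).
  exact: measurable_re_noise.
by move=> B; exact: re_noise_law.
Qed.

Lemma Rintegral_global_noise t j : (t < T)%N ->
  \int[P]_o (gglob t o 0 j * re_noise t j o) = 0.
Proof.
move=> tT.
transitivity (\int[P]_o (re_noise t j o * gglob t o 0 j)).
  by apply: eq_Rintegral => o _; rewrite mulrC.
rewrite (@Rintegral_mul_sigma_independent _ _ _ P (noise_sys noise t)
  (model_grad_sys c l w xi t `|` \bigcup_m fin_sys (batch t m))).
- rewrite (Rintegral_normal noise_sd_gt0) ?mul0r//.
    exact: measurable_re_noise.
  by move=> B; exact: re_noise_law.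
- exact: square_integrable_re_noise.
- exact: square_integrable_global_grad.
- exact: (fedsgd_noise_indep run).
- have := @vec_sys_measurable _ Om R d
    (fun o => map_mx (@complex.Re R) (noise t o)) (noise_sys noise t) j.
  move=> /(_ (fun A hA => or_introl hA)).
  by apply: eq_measurable_fun => o _; rewrite mxE.
- apply: sigma_measurable_sub (sigma_measurable_global_grad (t := t) j).
  by move=> A hA; left; exact: vec_sys_model_sub.
Qed.

(** The worst case, in which every batch is the whole data set while the average still divides by
    the nominal size B_m. *)
Definition mean_grad_bound : R := M%:R^-1 * \sum_(m < M)
  (batch_size m)%:R^-1 * ((n m)%:R * grad_bound p).

Lemma ae_mean_batch_grad_le t j : (t < T)%N ->
  {ae P, forall o, `|mean_batch_grad t o 0 j| <= mean_grad_bound}.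
Proof.
move=> tT.
have : {ae P, forall o, forall m (i : 'I_(n m)),
    `|sgrad t i o 0 j| <= grad_bound p}.
  apply: filter_forall => m; apply: filter_forall => i.
  exact: ae_sample_grad_coord_le.
apply: filterS => o ho; rewrite mean_batch_grad_coord /mean_grad_bound.
rewrite normrM ger0_norm ?invr_ge0// ler_wpM2l ?invr_ge0//.
apply: (le_trans (ler_norm_sum _ _ _)); apply: ler_sum => m _.
rewrite normrM ger0_norm ?invr_ge0// ler_wpM2l ?invr_ge0//.
apply: (le_trans (ler_norm_sum _ _ _)).
have -> : (n m)%:R * grad_bound p = \sum_(i < n m) grad_bound p.
  by rewrite sumr_const card_ord mulr_natl.
apply: ler_sum => i _; rewrite normrM /in_batch.
apply: le_trans (ho m i); case: (_ \in _).
  by rewrite normr1 mul1r.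
by rewrite normr0 mul0r.
Qed.

Lemma mean_batch_grad_sqr t j : (t < T)%N ->
  square_integrable P (fun o => mean_batch_grad t o 0 j) /\
  \int[P]_o (mean_batch_grad t o 0 j ^+ 2) <= mean_grad_bound ^+ 2.
Proof.
move=> tT; apply: square_integrable_ae_bounded.
  exact: measurable_mean_batch_grad.
exact: ae_mean_batch_grad_le.
Qed.

Lemma square_integrable_step t j : (t < T)%N -> square_integrable P (step t j).
Proof.
move=> tT; apply: square_integrableD; first exact: (mean_batch_grad_sqr j tT).1.
by apply: square_integrableZ; exact: square_integrable_re_noise.
Qed.

Lemma Rintegral_global_step t j : (t < T)%N ->
  \int[P]_o (gglob t o 0 j * step t j o) = \int[P]_o (gglob t o 0 j ^+ 2).
Proof.
move=> tT; have sphi := square_integrable_global_grad j tT.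
have [sgb _] := mean_batch_grad_sqr j tT.
have snn := square_integrable_re_noise j tT.
have i1 := square_integrable_mul sphi sgb.
have i2 := square_integrable_mul sphi snn.
transitivity (\int[P]_o (gglob t o 0 j * mean_batch_grad t o 0 j +
   (Num.sqrt (eta t))^-1 * (gglob t o 0 j * re_noise t j o))).
  by apply: eq_Rintegral => o _; rewrite /step mulrDr [in RHS]mulrCA.
rewrite RintegralD//; last exact: integrable_scale.
by rewrite RintegralZl// Rintegral_global_noise// mulr0 addr0
  Rintegral_global_mean_batch_grad.
Qed.

Local Notation noise_var := (normal_second_moment (noise_std p / Num.sqrt 2)).

(** The factor 2 stems from (a + b)^2 <= 2 (a^2 + b^2), and later cancels the 1/2 of the smoothness
    inequality. *)
Lemma Rintegral_step_sqr t j : (t < T)%N ->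
  \int[P]_o (step t j o ^+ 2) <=
  2 * (mean_grad_bound ^+ 2 + (eta t)^-1 * noise_var).
Proof.
move=> tT; have [[mg ig] lg] := mean_batch_grad_sqr j tT.
have [mn inn] := square_integrable_re_noise j tT.
have nvE : \int[P]_o (re_noise t j o ^+ 2) = noise_var.
  apply: (Rintegral_sqr_normal mn).
  by move=> B; exact: re_noise_law.
have isc := integrable_scale (eta t)^-1 inn.
apply: (@le_trans _ _ (\int[P]_o (2 * (mean_batch_grad t o 0 j ^+ 2 +
   (eta t)^-1 * re_noise t j o ^+ 2)))).
  apply: le_Rintegral => //.
  - by case: (square_integrable_step j tT).
  - by apply: integrable_scale; exact: integrable_add.
  - move=> o _; rewrite /step.
    have -> : (eta t)^-1 * re_noise t j o ^+ 2 =
        ((Num.sqrt (eta t))^-1 * re_noise t j o) ^+ 2.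
      by rewrite exprMn exprVn sqr_sqrtr// ltW// eta_gt0.
    set a := mean_batch_grad t o 0 j; set b := _ * _.
    have := sqr_ge0 (a - b); nra.
rewrite RintegralZl//; last exact: integrable_add.
by rewrite RintegralD// RintegralZl// nvE ler_wpM2l// lerD2r.
Qed.

Context (L : R).
Hypothesis L_gt0 : 0 < L.
Hypothesis smooth : smooth_losses pdata c l L.
Context (wstar : 'rV[R]_d).
Hypothesis wstar_min : forall v,
  global_loss pdata c l wstar <= global_loss pdata c l v.

(** The average of the local inequalities, split into coordinates so that only scalar products have
    to be integrated afterwards. *)
Lemma global_loss_smooth v v' :
  global_loss pdata c l v <= global_loss pdata c l v' +
    \sum_(j < d) (grad (global_loss pdata c l) v' 0 j * (v 0 j - v' 0 j) +
      L / 2 * (v 0 j - v' 0 j) ^+ 2).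
Proof.
have M0 : 0 < M%:R :> R by rewrite ltr0n ndev_ge1.
have -> : \sum_(j < d) (grad (global_loss pdata c l) v' 0 j * (v 0 j - v' 0 j) +
      L / 2 * (v 0 j - v' 0 j) ^+ 2) =
    M%:R^-1 * \sum_(m < M) (dotv (grad (local_loss pdata c l m) v') (v - v') +
      L / 2 * enorm (v - v') ^+ 2).
  rewrite big_split /= [RHS]mulr_sumr.
  under [RHS]eq_bigr do rewrite mulrDr.
  rewrite big_split /=; congr (_ + _).
    rewrite -mulr_sumr /dotv exchange_big /= mulr_sumr; apply: eq_bigr => j _.
    rewrite grad_global_loss -mulrA mulr_suml; congr (_ * _).
    by apply: eq_bigr => m _; rewrite !mxE.
  rewrite sumr_const card_ord enorm_sqr -mulr_sumr -[RHS]mulr_natl mulrA.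
  rewrite mulfV ?gt_eqF// mul1r; congr (_ * _).
  by apply: eq_bigr => j _; rewrite !mxE.
rewrite /global_loss -mulrDr -big_split /= ler_wpM2l ?invr_ge0 ?(ltW M0)//.
by apply: ler_sum => m _; have := smooth m v v'; rewrite addrA.
Qed.

Lemma descent_step t o : (t < T)%N ->
  global_loss pdata c l (w t.+1 o) <= global_loss pdata c l (w t o) -
    \sum_(j < d) (lam * (gglob t o 0 j * step t j o) -
      L / 2 * lam ^+ 2 * step t j o ^+ 2).
Proof.
move=> tT; apply: (le_trans (global_loss_smooth _ (w t o))).
rewrite lerD2l -sumrN; apply: ler_sum => j _.
rewrite update_coord// le_eqVlt; apply/orP; left; apply/eqP; ring.
Qed.

Lemma descent_total o :
  \sum_(t < T) \sum_(j < d) (lam * (gglob t o 0 j * step t j o) -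
      L / 2 * lam ^+ 2 * step t j o ^+ 2) <=
  global_loss pdata c l w0 - global_loss pdata c l wstar.
Proof.
have key k : (k <= T)%N ->
    \sum_(t < k) \sum_(j < d) (lam * (gglob t o 0 j * step t j o) -
      L / 2 * lam ^+ 2 * step t j o ^+ 2) <=
    global_loss pdata c l w0 - global_loss pdata c l (w k o).
  elim: k => [_|k IH kT]; first by rewrite big_ord0 (fedsgd_init run) subrr.
  rewrite big_ord_recr /=; have := IH (ltnW kT); have := descent_step o kT.
  lra.
have := key T (leqnn T); have := wstar_min (w T o); lra.
Qed.

Lemma sum_expected_grad_sqr :
  lam * \sum_(t < T) \sum_(j < d) \int[P]_o (gglob t o 0 j ^+ 2) <=
  global_loss pdata c l w0 - global_loss pdata c l wstar +
  L * lam ^+ 2 * d%:R * (T%:R * mean_grad_bound ^+ 2 +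
    noise_var * \sum_(t < T) (eta t)^-1).
Proof.
pose D (t : 'I_T) (j : 'I_d) o := lam * (gglob t o 0 j * step t j o) -
      L / 2 * lam ^+ 2 * step t j o ^+ 2.
have i1 (t : 'I_T) j : P.-integrable setT
    (EFin \o (fun o => gglob t o 0 j * step t j o)).
  apply: square_integrable_mul; first exact: square_integrable_global_grad.
  exact: square_integrable_step.
have i2 (t : 'I_T) j : P.-integrable setT (EFin \o (fun o => step t j o ^+ 2)).
  by case: (square_integrable_step j (ltn_ord t)).
have i3 (t : 'I_T) j : P.-integrable setT (EFin \o (fun o =>
    L / 2 * lam ^+ 2 * step t j o ^+ 2)).
  exact: integrable_scale.
have i4 (t : 'I_T) j : P.-integrable setT (EFin \o (fun o =>
    lam * (gglob t o 0 j * step t j o))).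
  exact: integrable_scale.
have iD t j : P.-integrable setT (EFin \o D t j).
  apply: eq_integrable (integrable_add (i4 t j) (integrable_scale (-1) (i3 t j))) => //.
  by move=> o _; rewrite /D /= mulN1r.
have iDs t : P.-integrable setT (EFin \o (fun o => \sum_(j < d) D t j o)).
  exact: integrable_big_sum.
have ID (t : 'I_T) j : lam * \int[P]_o (gglob t o 0 j ^+ 2) -
    L * lam ^+ 2 * (mean_grad_bound ^+ 2 + (eta t)^-1 * noise_var) <=
    \int[P]_o D t j o.
  rewrite /D RintegralB// !RintegralZl// Rintegral_global_step// lerD2l lerN2.
  have -> : L * lam ^+ 2 * (mean_grad_bound ^+ 2 + (eta t)^-1 * noise_var) =
    L / 2 * lam ^+ 2 * (2 * (mean_grad_bound ^+ 2 + (eta t)^-1 * noise_var)).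
    by set e := (eta t)^-1; field.
  apply: ler_wpM2l; last exact: Rintegral_step_sqr.
  by rewrite mulr_ge0 ?sqr_ge0// divr_ge0// ltW.
have total : \sum_(t < T) \sum_(j < d) \int[P]_o D t j o <=
    global_loss pdata c l w0 - global_loss pdata c l wstar.
  under eq_bigr do rewrite -Rintegral_big_sum//.
  rewrite -Rintegral_big_sum//.
  set Delta := (X in _ <= X).
  have PT : fine (P setT) = 1 by rewrite [X in fine X](probability_setT).
  rewrite -[leRHS]mulr1 -PT -(Rintegral_cst P measurableT).
  apply: le_Rintegral => //.
  - exact: integrable_big_sum.
  - exact: (finite_measure_integrable_cst P Delta).
  - by move=> o _; exact: descent_total.
rewrite -lerBlDr; apply: le_trans total.
apply: (@le_trans _ _ (\sum_(t < T) \sum_(j < d)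
   (lam * \int[P]_o (gglob t o 0 j ^+ 2) -
    L * lam ^+ 2 * (mean_grad_bound ^+ 2 + (eta t)^-1 * noise_var)))); last first.
  by apply: ler_sum => t _; apply: ler_sum => j _; exact: ID.
rewrite le_eqVlt; apply/orP; left; apply/eqP.
under [RHS]eq_bigr do rewrite sumrB -mulr_sumr sumr_const card_ord -[_ *+ d]mulr_natl.
rewrite sumrB -mulr_sumr; congr (_ - _).
transitivity (\sum_(t < T) (L * lam ^+ 2 * d%:R * mean_grad_bound ^+ 2 +
    L * lam ^+ 2 * d%:R * noise_var * (eta t)^-1)); last first.
  apply: eq_bigr => t _.
  move: (mean_grad_bound) (noise_var) (eta t)^-1 (d%:R : R) => a b e k; ring.
rewrite big_split /= sumr_const card_ord -mulr_sumr -[_ *+ T]mulr_natl.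
move: (mean_grad_bound) (noise_var) (\sum_(t < T) _) (d%:R : R) => a b e k; ring.
Qed.

Lemma sum_expectation_grad_sqr :
  (\sum_(t < T) 'E_P[fun o => (enorm (gglob t o) ^+ 2)%R])%E =
  (\sum_(t < T) \sum_(j < d) \int[P]_o (gglob t o 0 j ^+ 2))%:E.
Proof.
rewrite -sumEFin; apply: eq_bigr => t _; rewrite unlock.
have ig j : P.-integrable setT (EFin \o (fun o => gglob t o 0 j ^+ 2)).
  by case: (square_integrable_global_grad j (ltn_ord t)).
rewrite -Rintegral_big_sum// /Rintegral fineK; last first.
  exact/integrable_fin_num/integrable_big_sum.
by apply: eq_integral => o _; rewrite /= enorm_sqr.
Qed.

End fedsgd_run.

(** * Asymptotics in the horizon *)

Theorem corollary2 (R : realType) (p : ota_params R)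
  (h : 'I_(ndev p) -> nat -> R[i]) (h_lb h_ub : R)
  (h_lb_gt0 : 0 < h_lb) (h_lb_le_ub : h_lb <= h_ub)
  (h_bounds : forall t, h_lb <= dev_min (fun m => cabs (h m t)) <= h_ub)
  (beta V0 : R) (beta_gt1 : 1 < beta) (beta_lt2 : beta < 2) (V0_gt0 : 0 < V0)
  (xhat xstar : nat -> nat -> R)
  (xhat_adascale : forall T, (0 < T)%N ->
     adascale h (V0 * (T%:R `^ beta)) T (xhat T))
  (xstar_optimal : forall T, (0 < T)%N -> offline_optimal h T (xstar T)) :
  (exists b : nat -> R,
     b @ \oo --> (0 : R) /\
     forall T, (0 < T)%N ->
       T%:R^-1 * (\sum_(t < T) \sum_(m < ndev p)
         (privacy h m t (xhat T t) - privacy h m t (xstar T t))) <= b T)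
  /\
  (forall (dU dO : measure_display) (U : measurableType dU)
     (O : measurableType dO)
     (pdata : 'I_(ndev p) -> probability (U * O)%type R)
     (c : 'I_(ndev p) -> R) (l : 'rV[R]_(model_dim p) -> U * O -> R)
     (w0 : 'rV[R]_(model_dim p)) (lambda0 L A1 A2 C1 C2 : R)
     (dOm : nat -> measure_display) (Om : forall T, measurableType (dOm T))
     (P : forall T, probability (Om T) R)
     (w : forall T, nat -> Om T -> 'rV[R]_(model_dim p))
     (xi : forall T, nat -> forall m : 'I_(ndev p),
        'I_(data_size m) -> {RV (P T) >-> (U * O)%type})
     (batch : forall T, nat -> forall m : 'I_(ndev p),
        Om T -> {set 'I_(data_size m)})
     (noise : forall T, nat -> Om T -> 'rV[R[i]]_(model_dim p)),
   losses_well_defined pdata c l ->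
   0 < L -> smooth_losses pdata c l L ->
   minimum_attained pdata c l ->
   0 <= A1 -> 0 <= A2 ->
   (forall T, (0 < T)%N -> sample_noise_bounded pdata c l (w T) (xi T) A1 A2 T) ->
   0 <= C1 -> 0 <= C2 -> bounded_dissimilarity pdata c l C1 C2 ->
   0 < lambda0 ->
   (forall T, (0 < T)%N ->
      ota_fedsgd c l h (w T) (xi T) (batch T) (noise T)
        (lambda0 / Num.sqrt T%:R) (fun t => xhat T t * hmin h t ^+ 2) w0 T) ->
   (fun T => (T%:R^-1)%:E *
      \sum_(t < T) 'E_(P T)[fun o =>
        (enorm (grad (global_loss pdata c l) (w T t o)) ^+ 2)%R])%E
     @ \oo --> 0%:E).
Proof.
have [c c0 privc] := sum_privacy_bounds h_lb_gt0 h_bounds.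
have V_gt0 T : (0 < T)%N -> 0 < V0 * T%:R `^ beta.
  by move=> T0; rewrite mulr_gt0// powR_gt0// ltr0n.
set nu := noise_budget p.
split.
  (* This is T/V, which vanishes because beta > 1. *)
  pose r T : R := V0^-1 * T%:R `^ (- (beta - 1)).
  have r0 : r T @[T --> \oo] --> (0 : R).
    rewrite -[X in _ --> X](mulr0 V0^-1); apply: cvgMl_tmp.
    by apply: cvg_natr_powRN; rewrite subr_gt0.
  exists (fun T => nu * Num.sqrt (2 * c * r T) + nu ^+ 2 * r T); split.
    rewrite [X in _ --> X](_ : 0 = nu * 0 + nu ^+ 2 * 0); last first.
      by rewrite !mulr0 addr0.
    apply: cvgD; last exact: cvgMl_tmp.
    apply: cvgMl_tmp; rewrite -[X in _ --> X]sqrtr0.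
    have cr0 : 2 * c * r T @[T --> \oo] --> (0 : R).
      by rewrite -[X in _ --> X](mulr0 (2 * c)); exact: cvgMl_tmp.
    exact: (cvg_comp _ _ cr0 (@sqrt_continuous R 0)).
  move=> T T0; have [fs _] := xstar_optimal T T0.
  apply: (le_trans (adascale_regret c0 privc T0 (V_gt0 T T0)
    (xhat_adascale T T0) fs)).
  have -> // : T%:R / (V0 * T%:R `^ beta) = r T.
  have Tn0 : (T%:R : R) != 0 by rewrite pnatr_eq0 -lt0n.
  rewrite /r opprB powRD ?Tn0 ?implybT// powRr1// powRN.
  by rewrite invfM mulrCA.
move=> dU dO U O pdata cc l w0 lambda0 L A1 A2 C1 C2 dOm Om P w xi batch noise.
move=> losses L0 smooth [wstar wmin] _ _ zb _ _ _ lam0 run.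
have hn0 m t : h m t != 0.
  apply/eqP => h0; have := cabs_ge_lb h_bounds m t.
  by rewrite h0 /cabs /= expr0n /= addr0 sqrtr0 leNgt h_lb_gt0.
have etagt0 T t : (0 < T)%N -> (t < T)%N -> 0 < xhat T t * hmin h t ^+ 2.
  move=> T0 tT; have /andP[x0 _] := adascale_range (xhat_adascale T T0) tT.
  by rewrite mulr_gt0// exprn_gt0// (hmin_gt0 h_lb_gt0 h_bounds).
pose S T := \sum_(t < T) \sum_(j < model_dim p)
  \int[P T]_o (grad (global_loss pdata cc l) (w T t o) 0 j ^+ 2).
pose Delta := global_loss pdata cc l w0 - global_loss pdata cc l wstar.
pose g := mean_grad_bound p.
pose nv := normal_second_moment (noise_std p / Num.sqrt 2).
pose ds := (model_dim p)%:R * noise_std p ^+ 2.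
pose D := (xmax p * (h_lb / 2) ^+ 2)^-1.
pose dd : R := (model_dim p)%:R.
(* [s] is 1/sqrt T. [u] is T^(-3/2) sqrt(V T) up to the factor sqrt V0: its exponent is (beta + 1)/2
   - 3/2, negative because beta < 2. *)
pose s T : R := T%:R `^ (- 2^-1).
pose u T : R := T%:R `^ (- ((2 - beta) / 2)).
(* [sum_expected_grad_sqr] divided by lambda T: [K1] gathers the initial gap, the gradient steps and
   the part of the sum of the 1/eta_t linear in T, and [K2] the part coming from the queue bound. *)
pose K1 := Delta / lambda0 + L * lambda0 * dd * (g ^+ 2 + nv * (nu / ds + D)).
pose K2 := L * lambda0 * dd * nv * Num.sqrt (2 * V0 * c) / ds.
have s0 : s T @[T --> \oo] --> (0 : R) by exact: cvg_natr_powRN.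
have u0 : u T @[T --> \oo] --> (0 : R).
  by apply: cvg_natr_powRN; rewrite divr_gt0// subr_gt0.
have bound T : (0 < T)%N -> T%:R^-1 * S T <= K1 * s T + K2 * u T.
  move=> T0; have Tgt0 : 0 < (T%:R : R) by rewrite ltr0n.
  have Tn0 : (T%:R : R) != 0 by rewrite gt_eqF.
  have eta0 t : (t < T)%N -> 0 < xhat T t * hmin h t ^+ 2 by exact: etagt0.
  have := sum_expected_grad_sqr losses (run T T0) (zb T T0) hn0 eta0 L0 smooth
    wmin.
  rewrite -/(S T) -/Delta -/g -/nv -/dd.
  have := adascale_sum_inv_eta h_lb_gt0 h_bounds c0 privc (V_gt0 T T0)
    (xhat_adascale T T0).
  rewrite -/nu -/ds -/D; set q := Num.sqrt (_ * c * _).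
  set E := \sum_(t < T) _ => leE.
  have sE : Num.sqrt T%:R = (s T)^-1 by rewrite /s powRN invrK powR12_sqrt.
  have sgt0 : 0 < s T by rewrite powR_gt0.
  have s2 : s T ^+ 2 = T%:R^-1.
    by rewrite -[s T]invrK -sE exprVn sqr_sqrtr.
  have qE : s T * q = T%:R * (Num.sqrt (2 * V0 * c) * u T).
    have -> : q = Num.sqrt (2 * V0 * c) * T%:R `^ ((beta + 1) / 2).
      rewrite powRrM powR12_sqrt ?powR_ge0// -sqrtrM; last first.
        by rewrite !mulr_ge0// ltW.
      rewrite powRD ?Tn0 ?implybT// powRr1 ?(ltW Tgt0)// /q.
      by congr Num.sqrt; ring.
    rewrite mulrCA [RHS]mulrCA; congr (_ * _).
    rewrite /s /u -powRD ?Tn0 ?implybT//.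
    rewrite -[X in _ = X * _](powRr1 (ltW Tgt0)) -powRD ?Tn0 ?implybT//.
    by congr powR; field.
  rewrite sE invrK => main.
  have nv0 : 0 <= nv.
    by apply: Rintegral_ge0 => x _; rewrite mulr_ge0 ?sqr_ge0 ?normal_pdf_ge0.
  have dd0 : 0 <= dd by [].
  have k0 : 0 <= L * (lambda0 * s T) ^+ 2 * dd.
    apply: mulr_ge0 => //.
    by apply: mulr_ge0; [exact: ltW|exact: sqr_ge0].
  have {}main : lambda0 * s T * S T <= Delta + L * (lambda0 * s T) ^+ 2 * dd *
      (T%:R * g ^+ 2 + nv * ((q + T%:R * nu) / ds + T%:R * D)).
    apply: (le_trans main); rewrite lerD2l [X in _ <= X]mulrDr mulrDr lerD2l.
    by do 2 apply: ler_wpM2l => //.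
  have ls0 : 0 < lambda0 * s T by rewrite mulr_gt0.
  rewrite -(ler_pM2l ls0) [leLHS]mulrCA ler_pdivrMl//; apply: (le_trans main).
  have ds0 : ds != 0.
    by rewrite mulf_neq0 ?expf_neq0 ?pnatr_eq0 -?lt0n ?model_dim_ge1// gt_eqF
      ?noise_std_gt0.
  rewrite le_eqVlt; apply/orP; left; apply/eqP.
  rewrite exprMn mulrDl mulrDr.
  have sT : s T ^+ 2 * T%:R = 1 by rewrite s2 mulVf.
  (* Real powers are opaque to [field], so the relations among them are fed in by hand: factors
     [s T ^+ 2 * T%:R], equal to 1, are inserted, and [q] is made to occur only in [s T * q], where
     [qE] applies. *)
  transitivity (Delta * (s T ^+ 2 * T%:R) + L * lambda0 ^+ 2 * dd *
      ((s T ^+ 2 * T%:R) * g ^+ 2 + nv * ((s T * (s T * q) +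
        (s T ^+ 2 * T%:R) * nu) / ds + (s T ^+ 2 * T%:R) * D))).
    rewrite [in LHS](_ : Delta = Delta * (s T ^+ 2 * T%:R)); last first.
      by rewrite sT mulr1.
    by field.
  rewrite qE /K1 /K2; field.
  by rewrite ds0 gt_eqF.
have cvgS : T%:R^-1 * S T @[T --> \oo] --> (0 : R).
  apply: (@squeeze_cvgr _ _ _ _ (fun=> 0) (fun T => K1 * s T + K2 * u T)).
  - near=> T; have T0 : (0 < T)%N by near: T; exact: nbhs_infty_gt.
    rewrite bound// andbT mulr_ge0 ?invr_ge0//.
    apply: sumr_ge0 => t _; apply: sumr_ge0 => j _.
    by apply: Rintegral_ge0 => o _; exact: sqr_ge0.
  - exact: cvg_cst.
  - rewrite [X in _ --> X](_ : 0 = K1 * 0 + K2 * 0); last first.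
      by rewrite !mulr0 addr0.
    by apply: cvgD; exact: cvgMl_tmp.
have {}cvgS : (T%:R^-1 * S T)%:E @[T --> \oo] --> 0%:E.
  by apply: cvg_EFin; [near=> T|exact: cvgS].
(* The run is constrained for positive T only, so the expectations agree with the real integrals
   eventually rather than everywhere. *)
apply: cvg_trans cvgS; apply: near_eq_cvg; near=> T.
have T0 : (0 < T)%N by near: T; exact: nbhs_infty_gt.
by rewrite (sum_expectation_grad_sqr losses (run T T0) (zb T T0)) EFinM.
Unshelve. all: by end_near. Qed.
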